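(* Let $\mathbf{A}_1\in\mathbb{H}^{m\times n}_{r_1}$, $\mathbf{B}_1\in\mathbb{H}^{r\times s}_{r_2}$, $\mathbf{A}_2\in\mathbb{H}^{m\times p}_{r_3}$, $\mathbf{B}_2\in\mathbb{H}^{q\times s}_{r_4}$ and $\mathbf{C}\in\mathbb{H}^{m\times s}$. Put $\mathbf{M}=\mathbf{R}_{A_1}\mathbf{A}_2$, $\mathbf{N}=\mathbf{B}_2\mathbf{L}_{B_1}$, $\mathbf{S}=\mathbf{A}_2\mathbf{L}_M$, and let $\operatorname{rank}\mathbf{M}=r_5$, $\operatorname{rank}\mathbf{N}=r_6$, $\operatorname{rank}\mathbf{S}=r_7$. Consider the pair $$\mathbf{X}_1=\mathbf{A}_1^\dagger\mathbf{C}\mathbf{B}_1^\dagger-\mathbf{A}_1^\dagger\mathbf{A}_2\mathbf{M}^\dagger\mathbf{C}\mathbf{B}_1^\dagger-\mathbf{A}_1^\dagger\mathbf{S}\mathbf{A}_2^\dagger\mathbf{C}\mathbf{N}^\dagger\mathbf{B}_2\mathbf{B}_1^\dagger=(x^{(1)}_{ij})\in\mathbb{H}^{n\times r},\qquad \mathbf{X}_2=\mathbf{M}^\dagger\mathbf{C}\mathbf{B}_2^\dagger+\mathbf{P}_S\mathbf{A}_2^\dagger\mathbf{C}\mathbf{N}^\dagger=(x^{(2)}_{gf})\in\mathbb{H}^{p\times q}$$ (a partial solution of $\mathbf{A}_1\mathbf{X}_1\mathbf{B}_1+\mathbf{A}_2\mathbf{X}_2\mathbf{B}_2=\mathbf{C}$).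 Define the auxiliary matrices $\mathbf{C}_1=\mathbf{A}_1^*\mathbf{C}\mathbf{B}_1^*$, $\tilde{\mathbf{A}}_2=\mathbf{A}_1^*\mathbf{A}_2$ (with columns $\tilde{\mathbf{a}}^{(2)}_{.t}$), $\mathbf{C}_2=\mathbf{M}^*\mathbf{C}\mathbf{B}_1^*$, $\tilde{\mathbf{S}}=\mathbf{A}_1^*\mathbf{S}$ (columns $\tilde{\mathbf{s}}_{.t}$), $\tilde{\mathbf{B}}_2=\mathbf{B}_2\mathbf{B}_1^*$ (rows $\tilde{\mathbf{b}}^{(2)}_{f.}$), $\mathbf{C}_3=\mathbf{A}_2^*\mathbf{C}\mathbf{N}^*$, $\mathbf{C}_4=\mathbf{M}^*\mathbf{C}\mathbf{B}_2^*$, and let $\ddot{\mathbf{s}}_{.t}$ be the $t$th column of $\mathbf{S}^*\mathbf{S}$; for each $\mathbf{C}_\nu$ write $\mathbf{c}^{(\nu)}_{k.}$ and $\mathbf{c}^{(\nu)}_{.l}$ for its $k$th row and $l$th column. Then $$x^{(1)}_{ij}=x^{(11)}_{ij}-x^{(12)}_{ij}-x^{(13)}_{ij},\qquad x^{(2)}_{gf}=x^{(21)}_{gf}+x^{(22)}_{gf},$$ where: (1) $x^{(11)}_{ij}=\dfrac{\sum_{\beta\in J_{r_1,n}\{i\}}\mathrm{cdet}_i\big((\mathbf{A}_1^*\mathbf{A}_1)_{.i}(\mathbf{d}^{B_1}_{.j})\big)^\beta_\beta}{\sum_{\beta\in J_{r_1,n}}|\mathbf{A}_1^*\mathbf{A}_1|^\beta_\beta\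 \sum_{\alpha\in I_{r_2,r}}|\mathbf{B}_1\mathbf{B}_1^*|^\alpha_\alpha}=\dfrac{\sum_{\alpha\in I_{r_2,r}\{j\}}\mathrm{rdet}_j\big((\mathbf{B}_1\mathbf{B}_1^* )_{j.}(\mathbf{d}^{A_1}_{i.})\big)^\alpha_\alpha}{\sum_{\beta\in J_{r_1,n}}|\mathbf{A}_1^*\mathbf{A}_1|^\beta_\beta\ \sum_{\alpha\in I_{r_2,r}}|\mathbf{B}_1\mathbf{B}_1^*|^\alpha_\alpha}$, where $\mathbf{d}^{B_1}_{.j}\in\mathbb{H}^{n\times1}$ has $k$th entry $\sum_{\alpha\in I_{r_2,r}\{j\}}\mathrm{rdet}_j\big((\mathbf{B}_1\mathbf{B}_1^* )_{j.}(\mathbf{c}^{(1)}_{k.})\big)^\alpha_\alpha$ ($k=1,\dots,n$) and $\mathbf{d}^{A_1}_{i.}\in\mathbb{H}^{1\times r}$ has $l$th entry $\sum_{\beta\in J_{r_1,n}\{i\}}\mathrm{cdet}_i\big((\mathbf{A}_1^*\mathbf{A}_1)_{.i}(\mathbf{c}^{(1)}_{.l})\big)^\beta_\beta$ ($l=1,\dots,r$); (2) $x^{(12)}_{ij}=\dfrac{\sum_{t=1}^p\sum_{\beta\in J_{r_1,n}\{i\}}\mathrm{cdet}_i\big((\mathbf{A}_1^*\mathbf{A}_1)_{.i}(\tilde{\mathbf{a}}^{(2)}_{.t})\big)^\beta_\beta\,\varphi_{tj}}{\sum_{\beta\in J_{r_1,n}}|\mathbf{A}_1^*\mathbf{A}_1|^\beta_\beta\sum_{\beta\in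 J_{r_5,p}}|\mathbf{M}^*\mathbf{M}|^\beta_\beta\sum_{\alpha\in I_{r_2,r}}|\mathbf{B}_1\mathbf{B}_1^*|^\alpha_\alpha}$, where $\varphi_{tj}=\sum_{\beta\in J_{r_5,p}\{t\}}\mathrm{cdet}_t\big((\mathbf{M}^*\mathbf{M})_{.t}(\boldsymbol{\psi}^{B_1}_{.j})\big)^\beta_\beta=\sum_{\alpha\in I_{r_2,r}\{j\}}\mathrm{rdet}_j\big((\mathbf{B}_1\mathbf{B}_1^* )_{j.}(\boldsymbol{\psi}^{M}_{t.})\big)^\alpha_\alpha$, with $\boldsymbol{\psi}^{B_1}_{.j}\in\mathbb{H}^{p\times1}$ having $k$th entry $\sum_{\alpha\in I_{r_2,r}\{j\}}\mathrm{rdet}_j\big((\mathbf{B}_1\mathbf{B}_1^* )_{j.}(\mathbf{c}^{(2)}_{k.})\big)^\alpha_\alpha$ ($k=1,\dots,p$) and $\boldsymbol{\psi}^{M}_{t.}\in\mathbb{H}^{1\times r}$ having $l$th entry $\sum_{\beta\in J_{r_5,p}\{t\}}\mathrm{cdet}_t\big((\mathbf{M}^*\mathbf{M})_{.t}(\mathbf{c}^{(2)}_{.l})\big)^\beta_\beta$ ($l=1,\dots,r$); (3) $x^{(13)}_{ij}=\dfrac{\sum_{t=1}^p\sum_{f=1}^q\Big(\sum_{\beta\in J_{r_1,n}\{i\}}\mathrm{cdet}_i\big((\mathbf{A}_1^*\mathbf{A}_1)_{.i}(\tilde{\mathbf{s}}_{.t})\big)^\beta_\beta\Big)\,\eta_{tf}\,\Big(\sum_{\alpha\in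 I_{r_2,r}\{j\}}\mathrm{rdet}_j\big((\mathbf{B}_1\mathbf{B}_1^* )_{j.}(\tilde{\mathbf{b}}^{(2)}_{f.})\big)^\alpha_\alpha\Big)}{\sum_{\beta\in J_{r_1,n}}|\mathbf{A}_1^*\mathbf{A}_1|^\beta_\beta\sum_{\beta\in J_{r_3,p}}|\mathbf{A}_2^*\mathbf{A}_2|^\beta_\beta\sum_{\alpha\in I_{r_6,q}}|\mathbf{N}\mathbf{N}^*|^\alpha_\alpha\sum_{\alpha\in I_{r_2,r}}|\mathbf{B}_1\mathbf{B}_1^*|^\alpha_\alpha}$, where $\eta_{tf}=\sum_{\beta\in J_{r_3,p}\{t\}}\mathrm{cdet}_t\big((\mathbf{A}_2^*\mathbf{A}_2)_{.t}(\boldsymbol{\zeta}^{N}_{.f})\big)^\beta_\beta=\sum_{\alpha\in I_{r_6,q}\{f\}}\mathrm{rdet}_f\big((\mathbf{N}\mathbf{N}^* )_{f.}(\boldsymbol{\zeta}^{A_2}_{t.})\big)^\alpha_\alpha$, with $\boldsymbol{\zeta}^{N}_{.f}\in\mathbb{H}^{p\times1}$ having $k$th entry $\sum_{\alpha\in I_{r_6,q}\{f\}}\mathrm{rdet}_f\big((\mathbf{N}\mathbf{N}^* )_{f.}(\mathbf{c}^{(3)}_{k.})\big)^\alpha_\alpha$ ($k=1,\dots,p$) and $\boldsymbol{\zeta}^{A_2}_{t.}\in\mathbb{H}^{1\times q}$ having $l$th entry $\sum_{\beta\in J_{r_3,p}\{t\}}\mathrm{cdet}_t\big((\mathbf{A}_2^*\mathbf{A}_2)_{.t}(\mathbf{c}^{(3)}_{.l})\big)^\beta_\beta$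 ($l=1,\dots,q$); (4) $x^{(21)}_{gf}=\dfrac{\sum_{\beta\in J_{r_5,p}\{g\}}\mathrm{cdet}_g\big((\mathbf{M}^*\mathbf{M})_{.g}(\mathbf{d}^{B_2}_{.f})\big)^\beta_\beta}{\sum_{\beta\in J_{r_5,p}}|\mathbf{M}^*\mathbf{M}|^\beta_\beta\sum_{\alpha\in I_{r_4,q}}|\mathbf{B}_2\mathbf{B}_2^*|^\alpha_\alpha}=\dfrac{\sum_{\alpha\in I_{r_4,q}\{f\}}\mathrm{rdet}_f\big((\mathbf{B}_2\mathbf{B}_2^* )_{f.}(\mathbf{d}^{M}_{g.})\big)^\alpha_\alpha}{\sum_{\beta\in J_{r_5,p}}|\mathbf{M}^*\mathbf{M}|^\beta_\beta\sum_{\alpha\in I_{r_4,q}}|\mathbf{B}_2\mathbf{B}_2^*|^\alpha_\alpha}$, where $\mathbf{d}^{B_2}_{.f}\in\mathbb{H}^{p\times1}$ has $k$th entry $\sum_{\alpha\in I_{r_4,q}\{f\}}\mathrm{rdet}_f\big((\mathbf{B}_2\mathbf{B}_2^* )_{f.}(\mathbf{c}^{(4)}_{k.})\big)^\alpha_\alpha$ ($k=1,\dots,p$) and $\mathbf{d}^{M}_{g.}\in\mathbb{H}^{1\times q}$ has $l$th entry $\sum_{\beta\in J_{r_5,p}\{g\}}\mathrm{cdet}_g\big((\mathbf{M}^*\mathbf{M})_{.g}(\mathbf{c}^{(4)}_{.l})\big)^\beta_\beta$ ($l=1,\dots,q$); (5) $x^{(22)}_{gf}=\dfrac{\sum_{t=1}^p\sum_{\beta\in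 J_{r_7,p}\{g\}}\mathrm{cdet}_g\big((\mathbf{S}^*\mathbf{S})_{.g}(\ddot{\mathbf{s}}_{.t})\big)^\beta_\beta\,\eta_{tf}}{\sum_{\beta\in J_{r_7,p}}|\mathbf{S}^*\mathbf{S}|^\beta_\beta\sum_{\beta\in J_{r_3,p}}|\mathbf{A}_2^*\mathbf{A}_2|^\beta_\beta\sum_{\alpha\in I_{r_6,q}}|\mathbf{N}\mathbf{N}^*|^\alpha_\alpha}$, with $\eta_{tf}$ as in (3).
   Context: $\mathbb{H}$ is the skew field of real quaternions; $\mathbb{H}^{m\times n}$ is the set of $m\times n$ matrices over $\mathbb{H}$ and $\mathbb{H}^{m\times n}_r$ the subset of those of rank $r$. $\mathbf{A}^*$ is the conjugate transpose and $\mathbf{A}^\dagger$ the Moore–Penrose inverse (the unique $\mathbf{X}$ with $\mathbf{AXA}=\mathbf{A}$, $\mathbf{XAX}=\mathbf{X}$, $(\mathbf{AX})^*=\mathbf{AX}$, $(\mathbf{XA})^*=\mathbf{XA}$). $\mathbf{L}_A=\mathbf{I}-\mathbf{A}^\dagger\mathbf{A}$, $\mathbf{R}_A=\mathbf{I}-\mathbf{A}\mathbf{A}^\dagger$, $\mathbf{P}_A=\mathbf{A}^\dagger\mathbf{A}$, $\mathbf{Q}_A=\mathbf{A}\mathbf{A}^\dagger$. For a matrix $\mathbf{F}$, $\mathbf{F}_{.j}(\mathbf{b})$ (resp. $\mathbf{F}_{i.}(\mathbf{b})$) is $\mathbf{F}$ with its $j$th column (resp. $i$th row) replaced by the column (resp.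 row) $\mathbf{b}$. Row/column determinants: for $\mathbf{F}=(a_{ij})\in\mathbb{H}^{n\times n}$, $\mathrm{rdet}_i\mathbf{F}=\sum_{\sigma\in S_n}(-1)^{n-r}(a_{i\,i_{k_1}}a_{i_{k_1}i_{k_1+1}}\cdots a_{i_{k_1+l_1}i})\cdots(a_{i_{k_r}i_{k_r+1}}\cdots a_{i_{k_r+l_r}i_{k_r}})$, where $\sigma=(i\,i_{k_1}\,i_{k_1+1}\cdots i_{k_1+l_1})(i_{k_2}\cdots i_{k_2+l_2})\cdots(i_{k_r}\cdots i_{k_r+l_r})$ is the decomposition of $\sigma$ into $r$ disjoint cycles (fixed points included) with $i_{k_2}<\cdots<i_{k_r}$ and $i_{k_t}<i_{k_t+s}$ for $t=2,\dots,r$, $s=1,\dots,l_t$; and $\mathrm{cdet}_j\mathbf{F}=\sum_{\tau\in S_n}(-1)^{n-r}(a_{j_{k_r}j_{k_r+l_r}}\cdots a_{j_{k_r+1}j_{k_r}})\cdots(a_{j\,j_{k_1+l_1}}\cdots a_{j_{k_1+1}j_{k_1}}a_{j_{k_1}j})$, where $\tau=(j_{k_r+l_r}\cdots j_{k_r+1}\,j_{k_r})\cdots(j_{k_2+l_2}\cdots j_{k_2})(j_{k_1+l_1}\cdots j_{k_1+1}\,j_{k_1}\,j)$ is the decomposition into $r$ disjoint cycles with $j_{k_2}<\cdots<j_{k_r}$ and $j_{k_t}<j_{k_t+s}$ for $t=2,\dots,r$, $s=1,\dots,l_t$. For Hermitian $\mathbf{F}$ all these coincide and are real; this value is $\det\mathbf{F}$.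 Index sets: $L_{k,n}$ is the set of strictly increasing sequences $\alpha=(\alpha_1<\cdots<\alpha_k)$ in $\{1,\dots,n\}$; $I_{k,m}\{i\}=\{\alpha\in L_{k,m}: i\in\alpha\}$, $J_{k,n}\{j\}=\{\beta\in L_{k,n}: j\in\beta\}$; sums over $J_{k,n}$ or $I_{k,m}$ without braces run over all of $L_{k,n}$, $L_{k,m}$. For a square $\mathbf{F}$, $\mathbf{F}^\alpha_\alpha$ is the principal submatrix with rows and columns indexed by $\alpha$; $\mathrm{cdet}_i(\mathbf{G})^\beta_\beta$ (resp. $\mathrm{rdet}_j(\mathbf{G})^\alpha_\alpha$) is the column (resp. row) determinant of the principal submatrix $\mathbf{G}^\beta_\beta$ taken at the column (resp. row) coming from index $i$ (resp. $j$); for Hermitian $\mathbf{F}$, $|\mathbf{F}|^\alpha_\alpha=\det\mathbf{F}^\alpha_\alpha$. *)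

(* Defs.v *)
From HB Require Import structures.
From mathcomp Require Import all_boot all_order all_algebra all_fingroup.
From mathcomp Require Import reals.
From mathcomp Require Import ring.
From Stdlib Require Import ClassicalEpsilon.

Set Implicit Arguments.
Unset Strict Implicit.
Unset Printing Implicit Defensive.

Import Order.TTheory GRing.Theory Num.Theory.
Local Open Scope ring_scope.

Section Quat.
Variable R : comNzRingType.

Record quat := Quat { q0 : R; q1 : R; q2 : R; q3 : R }.

Definition quat_to (q : quat) := (q0 q, q1 q, q2 q, q3 q).
Definition quat_of (x : R * R * R * R) := let: (a, b, c, d) := x in Quat a b c d.
Lemma quat_toK : cancel quat_to quat_of. Proof. by case. Qed.

HB.instance Definition _ := Equality.copy quat (can_type quat_toK).
HB.instance Definition _ := Choice.copy quat (can_type quat_toK).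

Definition qzero := Quat 0 0 0 0.
Definition qopp (a : quat) := Quat (- q0 a) (- q1 a) (- q2 a) (- q3 a).
Definition qadd (a b : quat) :=
  Quat (q0 a + q0 b) (q1 a + q1 b) (q2 a + q2 b) (q3 a + q3 b).

Lemma qaddA : associative qadd.
Proof. by move=> [? ? ? ?] [? ? ? ?] [? ? ? ?]; rewrite /qadd /= !addrA. Qed.
Lemma qaddC : commutative qadd.
Proof.
by move=> [a b c d] [e f g h]; rewrite /qadd /= (addrC a) (addrC b) (addrC c) (addrC d).
Qed.
Lemma qadd0 : left_id qzero qadd.
Proof. by move=> [? ? ? ?]; rewrite /qadd /= !add0r. Qed.
Lemma qaddN : left_inverse qzero qopp qadd.
Proof. by move=> [? ? ? ?]; rewrite /qadd /= !addNr. Qed.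

HB.instance Definition _ := GRing.isZmodule.Build quat qaddA qaddC qadd0 qaddN.

Lemma qaddE (a b : quat) : a + b = qadd a b. Proof. by []. Qed.

Definition qone := Quat 1 0 0 0.
(* Hamilton product: i^2 = j^2 = k^2 = ijk = -1 *)
Definition qmul (a b : quat) :=
  Quat (q0 a * q0 b - q1 a * q1 b - q2 a * q2 b - q3 a * q3 b)
       (q0 a * q1 b + q1 a * q0 b + q2 a * q3 b - q3 a * q2 b)
       (q0 a * q2 b - q1 a * q3 b + q2 a * q0 b + q3 a * q1 b)
       (q0 a * q3 b + q1 a * q2 b - q2 a * q1 b + q3 a * q0 b).

Lemma qmulA : associative qmul.
Proof.
move=> [a0 a1 a2 a3] [b0 b1 b2 b3] [c0 c1 c2 c3]; rewrite /qmul /=.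
by congr Quat; ring.
Qed.
Lemma qmul1 : left_id qone qmul.
Proof. move=> [a0 a1 a2 a3]; rewrite /qmul /=; congr Quat; ring. Qed.
Lemma qmulr1 : right_id qone qmul.
Proof. move=> [a0 a1 a2 a3]; rewrite /qmul /=; congr Quat; ring. Qed.
Lemma qmulDl : left_distributive qmul +%R.
Proof.
move=> [a0 a1 a2 a3] [b0 b1 b2 b3] [c0 c1 c2 c3].
rewrite !qaddE /qmul /qadd /=; congr Quat; ring.
Qed.
Lemma qmulDr : right_distributive qmul +%R.
Proof.
move=> [a0 a1 a2 a3] [b0 b1 b2 b3] [c0 c1 c2 c3].
rewrite !qaddE /qmul /qadd /=; congr Quat; ring.
Qed.
Lemma qone_neq0 : qone != 0.
Proof.
apply/eqP => /(congr1 q0) /= /eqP; rewrite oner_eq0 //.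
Qed.

HB.instance Definition _ :=
  GRing.Zmodule_isNzRing.Build quat qmulA qmul1 qmulr1 qmulDl qmulDr qone_neq0.

Definition qconj (a : quat) := Quat (q0 a) (- q1 a) (- q2 a) (- q3 a).

Definition qreal (x : R) := Quat x 0 0 0.
End Quat.

Section QuatField.
Variable R : realType.
(* inverse of a quaternion: q^-1 = conj q / |q|^2 (and 0^-1 = 0) *)
Definition qinv (a : quat R) : quat R :=
  let n := q0 a ^+ 2 + q1 a ^+ 2 + q2 a ^+ 2 + q3 a ^+ 2 in
  Quat (q0 a / n) (- q1 a / n) (- q2 a / n) (- q3 a / n).
End QuatField.

Section QMatrix.
Variable R : realType.
Local Notation H := (quat R).

Definition adjq m n (A : 'M[H]_(m, n)) : 'M[H]_(n, m) :=
  \matrix_(i, j) qconj (A j i).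

Definition is_MP m n (A : 'M[H]_(m, n)) (X : 'M[H]_(n, m)) : Prop :=
  [/\ A *m X *m A = A, X *m A *m X = X,
      adjq (A *m X) = A *m X & adjq (X *m A) = X *m A].

Definition pinvq m n (A : 'M[H]_(m, n)) : 'M[H]_(n, m) :=
  epsilon (inhabits 0) (is_MP A).

Definition LA m n (A : 'M[H]_(m, n)) : 'M[H]_n := 1%:M - pinvq A *m A.
Definition RA m n (A : 'M[H]_(m, n)) : 'M[H]_m := 1%:M - A *m pinvq A.
Definition PA m n (A : 'M[H]_(m, n)) : 'M[H]_n := pinvq A *m A.

(* rank over the skew field H : maximal number of (right) linearly
   independent columns *)
Definition col_indep m n (A : 'M[H]_(m, n)) : Prop :=
  forall v : 'cV[H]_n, A *m v = 0 -> v = 0.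
Definition is_rankq m n (A : 'M[H]_(m, n)) (k : nat) : Prop :=
  (exists f : 'I_k -> 'I_n, injective f /\ col_indep (colsub f A)) /\
  (forall k' (f : 'I_k' -> 'I_n), injective f -> col_indep (colsub f A) -> k' <= k)%N.

Definition colrep m n (F : 'M[H]_(m, n)) (j : 'I_n) (b : 'cV[H]_m) :=
  \matrix_(x, y) if y == j then b x 0 else F x y.
Definition rowrep m n (F : 'M[H]_(m, n)) (i : 'I_m) (b : 'rV[H]_n) :=
  \matrix_(x, y) if x == i then b 0 y else F x y.

Section RCdet.
Variable n : nat.
Implicit Types (F : 'M[H]_n) (s : 'S_n).

Definition cycprod F s (x : 'I_n) : H :=
  \prod_(k < #|porbit s x|) F ((s ^+ k)%g x) ((s ^+ k.+1)%g x).

Definition cycmin s (x : 'I_n) : bool := [forall y in porbit s x, x <= y]%N.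

Definition cycsign s : H := (-1) ^+ (n - #|porbits s|).

Definition rdet (i : 'I_n) F : H :=
  \sum_(s : 'S_n) cycsign s *
    (cycprod F s i *
     \prod_(x < n | (x \notin porbit s i) && cycmin s x) cycprod F s x).

Definition cdet (j : 'I_n) F : H :=
  \sum_(s : 'S_n) cycsign s *
    ((\prod_(x <- rev (enum 'I_n) | (x \notin porbit s j) && cycmin s x)
        cycprod F s x) * cycprod F s j).
End RCdet.

(* determinant of a Hermitian matrix (all rdet_i, cdet_i coincide);
   the empty determinant is 1 *)
Definition hdet k : 'M[H]_k -> H :=
  match k with 0 => fun _ => 1 | k'.+1 => fun F => rdet ord0 F end.

Definition psub n (F : 'M[H]_n) (b : {set 'I_n}) : 'M[H]_#|b| :=
  \matrix_(x, y) F (enum_val x) (enum_val y).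

(* cdet_i / rdet_i of the principal submatrix F^b_b taken at the position
   of the index i in b (i is assumed to belong to b) *)
Definition cdet_sub n (F : 'M[H]_n) (b : {set 'I_n}) (i : 'I_n) : H :=
  if [pick x : 'I_#|b| | enum_val x == i] is Some x then cdet x (psub F b)
  else 0.
Definition rdet_sub n (F : 'M[H]_n) (b : {set 'I_n}) (i : 'I_n) : H :=
  if [pick x : 'I_#|b| | enum_val x == i] is Some x then rdet x (psub F b)
  else 0.

Definition cdsum n (F : 'M[H]_n) (k : nat) (i : 'I_n) (c : 'cV[H]_n) : H :=
  \sum_(b : {set 'I_n} | (#|b| == k) && (i \in b)) cdet_sub (colrep F i c) b i.
Definition rdsum n (F : 'M[H]_n) (k : nat) (j : 'I_n) (c : 'rV[H]_n) : H :=
  \sum_(b : {set 'I_n} | (#|b| == k) && (j \in b)) rdet_sub (rowrep F j c) b j.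
Definition minsum n (F : 'M[H]_n) (k : nat) : H :=
  \sum_(b : {set 'I_n} | #|b| == k) hdet (psub F b).

End QMatrix.

(* Main.v *)
(* For a Hermitian quaternion matrix F = A^* A let d_k be the sum of its principal
   minors of size k and let T_k be the matrix representing v |-> (sum over k-subsets
   b containing i of cdet_i of F with column i replaced by v, restricted to b)_i.
   Reversing a cycle conjugates its product, so inside cdet_i every cycle that avoids i
   may be replaced by its real part, and multiplying a permutation by the transposition
   (i j) merges or splits the cycles through i and j.  This gives
     T_0 = 0,   T_{k+1} = d_k I - T_k F,   T_{n+1} = 0,
   hence T_k commutes with F.  If A has rank k, then d_k > 0 and d_l = 0 for l > k, so
   F T_{k+1} = 0, i.e. F T_k F = d_k F, and d_k^-1 T_k A^* satisfies the four Penrose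
   equations.  Row determinants follow by conjugate transposition, because A A^* and
   A^* A have the same coefficients d_k. *)
Require Import Defs.
From HB Require Import structures.
From mathcomp Require Import all_boot all_order all_algebra all_fingroup.
From mathcomp Require Import reals.
From mathcomp Require Import ring zify.
From Stdlib Require Import ClassicalEpsilon.

Set Implicit Arguments.
Unset Strict Implicit.
Unset Printing Implicit Defensive.

Import Order.TTheory GRing.Theory Num.Theory.
Local Open Scope ring_scope.

(** * Quaternions and conjugate transposes *)

Section QuaternionRing.
Variable R : realType.
Local Notation H := (quat R).
Implicit Types (a b : H) (x y : R).

Lemma quat_eqP a b :
  [/\ q0 a = q0 b, q1 a = q1 b, q2 a = q2 b & q3 a = q3 b] -> a = b.
Proof. by case: a b => ? ? ? ? [? ? ? ?] /= [-> -> -> ->]. Qed.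


Fact qreal_zmod_morphism : zmod_morphism (@qreal R).
Proof. by move=> x y; apply: quat_eqP; split; rewrite /= ?subr0. Qed.
HB.instance Definition _ := GRing.isZmodMorphism.Build R H (@qreal R) qreal_zmod_morphism.
Fact qreal_monoid_morphism : monoid_morphism (@qreal R).
Proof. by split=> // x y; apply: quat_eqP; split; rewrite /=; ring. Qed.
HB.instance Definition _ := GRing.isMonoidMorphism.Build R H (@qreal R) qreal_monoid_morphism.

Lemma qreal_inj : injective (@qreal R). Proof. by move=> x y []. Qed.

Lemma qreal_comm x a : qreal x * a = a * qreal x.
Proof. by case: a => *; apply: quat_eqP; split; rewrite /=; ring. Qed.

Fact qconj_zmod_morphism : zmod_morphism (@qconj R).
Proof. by move=> a b; apply: quat_eqP; split; rewrite //= opprD. Qed.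
HB.instance Definition _ := GRing.isZmodMorphism.Build H H (@qconj R) qconj_zmod_morphism.

Lemma qconjK : involutive (@qconj R).
Proof. by move=> a; apply: quat_eqP; split; rewrite //= opprK. Qed.

Lemma qconjM a b : qconj (a * b) = qconj b * qconj a.
Proof. by case: a b => [? ? ? ?] [? ? ? ?]; apply: quat_eqP; split; rewrite /=; ring. Qed.

Lemma qconj_real x : qconj (qreal x) = qreal x.
Proof. by rewrite /qconj /= oppr0. Qed.

Lemma qconj1 : qconj (1 : H) = 1. Proof. exact: (qconj_real 1). Qed.

Lemma qaddConj a : a + qconj a = qreal (q0 a *+ 2).
Proof. by case: a => *; apply: quat_eqP; split; rewrite /= ?subrr. Qed.

Lemma qmul_conj a :
  a * qconj a = qreal (q0 a ^+ 2 + q1 a ^+ 2 + q2 a ^+ 2 + q3 a ^+ 2).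
Proof. by case: a => *; apply: quat_eqP; split; rewrite /=; ring. Qed.

Lemma qconj_mul a :
  qconj a * a = qreal (q0 a ^+ 2 + q1 a ^+ 2 + q2 a ^+ 2 + q3 a ^+ 2).
Proof. by rewrite -{2}[a]qconjK qmul_conj /= !sqrrN. Qed.

Fact q0_zmod_morphism : zmod_morphism (@q0 R). Proof. by []. Qed.
HB.instance Definition _ := GRing.isZmodMorphism.Build H R (@q0 R) q0_zmod_morphism.

Lemma q0M_comm a b : q0 (a * b) = q0 (b * a).
Proof. by case: a b => [? ? ? ?] [? ? ? ?] /=; ring. Qed.
Lemma q0_conj a : q0 (qconj a) = q0 a. Proof. by []. Qed.

Lemma qmul_real_eq0 x a : qreal x * a = 0 -> x != 0 -> a = 0.
Proof.
move=> xa0 nx; rewrite -[a]mul1r -(rmorph1 (@qreal R)) -(mulVf nx) rmorphM.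
by rewrite -mulrA xa0 mulr0.
Qed.

(** Cancels the factor 2 that appears when a sum is added to its image under cycle reversal. *)
Lemma addrr_inj a b : a + a = b + b -> a = b.
Proof.
rewrite -!mulr2n => /eqP; rewrite -subr_eq0 -mulrnBl -mulr_natl.
rewrite -(rmorph_nat (@qreal R)) => /eqP/qmul_real_eq0 ab0.
by apply/eqP; rewrite -subr_eq0 ab0 // pnatr_eq0.
Qed.

Lemma qinv_real x : qinv (qreal x) = qreal x^-1.
Proof.
rewrite /qinv /= !expr0n /= !addr0 oppr0 !mul0r /qreal; congr Quat.
(* At 0 both inverses take the default value 0. *)
have [->|nx] := eqVneq x 0; first by rewrite mul0r invr0.
by rewrite expr2 invfM mulrA divff // mul1r.
Qed.

Lemma qconj_prod (I : Type) (l : seq I) (P : pred I) (f : I -> H) :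
  qconj (\prod_(k <- l | P k) f k) = \prod_(k <- rev l | P k) qconj (f k).
Proof.
elim: l => [|x l IH]; first by rewrite /= !big_nil qconj1.
rewrite big_cons rev_cons -cats1 big_cat /= big_cons big_nil mulr1.
by case: ifP => _; rewrite -IH ?mulr1 // qconjM.
Qed.

End QuaternionRing.

(** * Conjugate transposes, real scalars and norms of matrices *)

Section QuaternionMatrix.
Variable R : realType.
Local Notation H := (quat R).

Lemma adjqK m n : cancel (@adjq R m n) (@adjq R n m).
Proof. by move=> A; apply/matrixP=> i j; rewrite !mxE qconjK. Qed.

Lemma adjqM m n p (A : 'M[H]_(m, n)) (B : 'M[H]_(n, p)) :
  adjq (A *m B) = adjq B *m adjq A.
Proof.
apply/matrixP=> i j; rewrite !mxE raddf_sum; apply: eq_bigr => k _.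
by rewrite /= qconjM !mxE.
Qed.

Fact adjq_zmod_morphism m n : zmod_morphism (@adjq R m n).
Proof. by move=> A B; apply/matrixP=> i j; rewrite !mxE raddfB. Qed.
HB.instance Definition _ m n :=
  GRing.isZmodMorphism.Build 'M[H]_(m, n) 'M[H]_(n, m) (@adjq R m n) (@adjq_zmod_morphism m n).

Lemma adjq_scale m n x (A : 'M[H]_(m, n)) : adjq (qreal x *: A) = qreal x *: adjq A.
Proof. by apply/matrixP=> i j; rewrite !mxE qconjM qconj_real qreal_comm. Qed.

Lemma adjq_scalar n x : adjq ((qreal x)%:M : 'M[H]_n) = (qreal x)%:M.
Proof.
by apply/matrixP=> i j; rewrite !mxE eq_sym; case: eqP => _; rewrite ?qconj_real ?raddf0.
Qed.

Lemma qscaleAr m n p x (A : 'M[H]_(m, n)) (B : 'M[H]_(n, p)) :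
  A *m (qreal x *: B) = qreal x *: (A *m B).
Proof.
apply/matrixP=> i j; rewrite !mxE mulr_sumr; apply: eq_bigr => k _.
by rewrite !mxE !mulrA qreal_comm.
Qed.

Lemma mul_qscalar_mx m n x (A : 'M[H]_(m, n)) : (qreal x)%:M *m A = qreal x *: A.
Proof. by rewrite -scalemx1 -scalemxAl mul1mx. Qed.

Lemma mul_mx_qscalar m n x (A : 'M[H]_(m, n)) : A *m (qreal x)%:M = qreal x *: A.
Proof. by rewrite -scalemx1 qscaleAr mulmx1. Qed.

Lemma qscale_inj m n x (A B : 'M[H]_(m, n)) :
  x != 0 -> qreal x *: A = qreal x *: B -> A = B.
Proof.
move=> nx /matrixP AB; apply/matrixP=> i j; apply/eqP; rewrite -subr_eq0; apply/eqP.
by apply: (@qmul_real_eq0 _ x) => //; move: (AB i j); rewrite !mxE mulrBr => ->; rewrite subrr.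
Qed.

Lemma qscaleK m n x (A : 'M[H]_(m, n)) : x != 0 -> qreal x^-1 *: (qreal x *: A) = A.
Proof. by move=> nx; rewrite scalerA -rmorphM mulVf // rmorph1 scale1r. Qed.

Definition sqnorm n (v : 'cV[H]_n) : R :=
  \sum_k (q0 (v k 0) ^+ 2 + q1 (v k 0) ^+ 2 + q2 (v k 0) ^+ 2 + q3 (v k 0) ^+ 2).

Lemma adjq_mulE n (v : 'cV[H]_n) : (adjq v *m v) 0 0 = qreal (sqnorm v).
Proof.
by rewrite mxE rmorph_sum; apply: eq_bigr => k _; rewrite mxE qconj_mul.
Qed.

Lemma sqnorm_ge0 n (v : 'cV[H]_n) : 0 <= sqnorm v.
Proof. by apply: sumr_ge0 => k _; rewrite !addr_ge0 ?sqr_ge0. Qed.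

Lemma sqnorm_eq0 n (v : 'cV[H]_n) : sqnorm v = 0 -> v = 0.
Proof.
move/eqP; rewrite psumr_eq0 => [/allP v0|k _]; last by rewrite !addr_ge0 ?sqr_ge0.
apply/colP => k; rewrite mxE; move: (v0 k (mem_index_enum _)) => /=.
rewrite !paddr_eq0 ?addr_ge0 ?sqr_ge0 // !sqrf_eq0.
by case/andP=> /andP[/andP[/eqP ? /eqP ?] /eqP ?] /eqP ?; apply: quat_eqP.
Qed.

(** For each column [v] of [X], the squared norm of [A v] is [v^* A^* A v = 0]. *)
Lemma adjq_mul_eq0 m n p (A : 'M[H]_(m, n)) (X : 'M[H]_(n, p)) :
  adjq A *m A *m X = 0 -> A *m X = 0.
Proof.
move=> AAX; apply/matrixP => i j; rewrite [RHS]mxE.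
suff /colP/(_ i) : col j (A *m X) = 0 by rewrite mxE [in RHS]mxE.
apply: sqnorm_eq0; apply: qreal_inj; rewrite -adjq_mulE colE -mulmxA adjqM -mulmxA.
by rewrite !(mulmxA _ A) [adjq A *m A *m _]mulmxA AAX mul0mx mulmx0 mxE rmorph0.
Qed.

(** Over a skew field the trace is not cyclic, but its real part is, because [ab] and [ba] have the
    same real part. *)
Lemma q0_trC m n (A : 'M[H]_(m, n)) (B : 'M[H]_(n, m)) :
  q0 (\tr (A *m B)) = q0 (\tr (B *m A)).
Proof.
rewrite /mxtrace !raddf_sum; under eq_bigr do rewrite mxE raddf_sum.
rewrite exchange_big; apply: eq_bigr => j _; rewrite mxE raddf_sum.
by apply: eq_bigr => i _; exact: q0M_comm.
Qed.

End QuaternionMatrix.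

(** * Orbits of permutations *)

Section PermOrbits.
Variable T : finType.
Implicit Types (s t : {perm T}) (x y i j : T) (A : {set T}).

(** By finiteness such a set is a union of cycles of [s]. *)
Definition pclosed s A := forall x, x \in A -> s x \in A.

Lemma permXS s k x : (s ^+ k.+1)%g x = s ((s ^+ k)%g x).
Proof. by rewrite expgSr permM. Qed.
Lemma permXSl s k x : (s ^+ k.+1)%g x = (s ^+ k)%g (s x).
Proof. by rewrite expgS permM. Qed.

Lemma pclosedX s A x k : pclosed s A -> x \in A -> (s ^+ k)%g x \in A.
Proof.
by move=> As xA; elim: k => [|k IH]; rewrite ?expg0 ?perm1 // permXS As.
Qed.

Lemma permX_agree s t A x k :
  pclosed s A -> {in A, s =1 t} -> x \in A -> (s ^+ k)%g x = (t ^+ k)%g x.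
Proof.
move=> As st xA; elim: k => [|k IH]; first by rewrite !expg0.
by rewrite !permXS -IH st // pclosedX.
Qed.

Lemma porbit_agree s t A x :
  pclosed s A -> {in A, s =1 t} -> x \in A -> porbit s x = porbit t x.
Proof.
move=> As st xA; apply/setP => y; apply/porbitP/porbitP => -[k ->]; exists k.
  exact: permX_agree st xA.
by rewrite (permX_agree k As st xA).
Qed.

Lemma pclosed_porbit s x : pclosed s (porbit s x).
Proof. by move=> y /porbitP[k ->]; rewrite -permXS mem_porbit. Qed.

Lemma porbit_permr s x y : (s y \in porbit s x) = (y \in porbit s x).
Proof. by rewrite ![_ \in porbit s x]porbit_sym -(porbit_perm s 1 y) expg1. Qed.

Lemma pclosedV s A : pclosed s A -> pclosed (s^-1)%g A.
Proof.
move=> As x xA; have /porbitP[k ->] : (s^-1)%g x \in porbit s x.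
  by rewrite -porbitV (mem_porbit _ 1).
exact: pclosedX.
Qed.

Lemma pclosedC s A : pclosed s A -> pclosed s (~: A).
Proof.
move=> /pclosedV As x; rewrite !inE; apply: contra => /As.
by rewrite permK.
Qed.

Lemma pclosedD s A B : pclosed s A -> pclosed s B -> pclosed s (A :\: B).
Proof. by move=> As /pclosedC Bs x; rewrite !inE => /andP[xB xA]; rewrite As // andbT -in_setC Bs ?inE. Qed.

Lemma perm_on_pclosed s A : perm_on A s -> pclosed s A.
Proof. by move=> As x; rewrite perm_closed. Qed.

Lemma perm_onP A s : reflect (forall x, x \notin A -> s x = x) (perm_on A s).
Proof.
apply: (iffP idP) => [As x|As]; first exact: out_perm.
by apply/subsetP => x; rewrite inE; apply: contraR => /As ->.
Qed.

Lemma porbit_sub s A x : pclosed s A -> x \in A -> porbit s x \subset A.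
Proof. by move=> As xA; apply/subsetP => y /porbitP[k ->]; apply: pclosedX. Qed.

Lemma permX_porbit s x : (s ^+ #|porbit s x|)%g x = x.
Proof. by rewrite permX iter_porbit. Qed.

Lemma permX_neq s x k : (0 < k < #|porbit s x|)%N -> (s ^+ k)%g x != x.
Proof.
case/andP=> k0 kN; have := uniq_traject_porbit s x => U.
have /(_ k 0%N) := nth_uniq x _ _ U; rewrite size_traject kN (leq_trans _ kN) //.
move=> /(_ isT isT); rewrite !nth_traject ?(leq_trans _ kN) // -permX /= => ->.
by rewrite -lt0n.
Qed.

Lemma porbit_lt s x y :
  y \in porbit s x -> exists2 k, (k < #|porbit s x|)%N & y = (s ^+ k)%g x.
Proof.
by rewrite porbit_traject => /trajectP[k kN ->]; exists k => //; rewrite permX.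
Qed.

Lemma card_porbit_gt0 s x : (0 < #|porbit s x|)%N.
Proof. by rewrite lt0n card_porbit_neq0. Qed.

Lemma permX_pred s x : (s ^+ #|porbit s x|.-1)%g x = (s^-1)%g x.
Proof.
by apply: (@perm_inj _ s); rewrite -permXS prednK ?card_porbit_gt0 // permX_porbit permKV.
Qed.

Lemma porbit_fix s x : s x = x -> porbit s x = [set x].
Proof.
move=> sx; apply/setP => y; rewrite inE; apply/porbitP/eqP => [[k ->]|->].
  by rewrite permX_fix.
by exists 0%N; rewrite expg0 perm1.
Qed.

(** Inverts the cycle through [j] only. Orbits and parity survive, so [s] can be paired with its
    image to average a cycle product with its conjugate. *)
Definition rev_fun s j x := if x \in porbit s j then (s^-1)%g x else s x.

Fact rev_fun_inj s j : injective (rev_fun s j).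
Proof.
have mV z : ((s^-1)%g z \in porbit s j) = (z \in porbit s j).
  by rewrite -[in RHS](permKV s z) porbit_permr.
rewrite /rev_fun => x y; case: ifP; case: ifP => yj xj; try exact: perm_inj.
  by move=> e; move: (mV x); rewrite e porbit_permr yj xj.
by move=> e; move: (mV y); rewrite -e porbit_permr yj xj.
Qed.

Definition rev_perm s j : {perm T} := perm (@rev_fun_inj s j).

Lemma rev_permE s j x : rev_perm s j x = if x \in porbit s j then (s^-1)%g x else s x.
Proof. by rewrite permE. Qed.

Lemma rev_perm_in s j : {in porbit s j, (s^-1)%g =1 rev_perm s j}.
Proof. by move=> x xj; rewrite rev_permE xj. Qed.

Lemma rev_perm_out s j : {in ~: porbit s j, s =1 rev_perm s j}.
Proof. by move=> x; rewrite inE rev_permE => /negPf->. Qed.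

Lemma porbit_rev s j x : porbit (rev_perm s j) x = porbit s x.
Proof.
have [xj|xj] := boolP (x \in porbit s j).
  rewrite -(porbit_agree _ (@rev_perm_in s j) xj) ?porbitV //.
  by apply: pclosedV; exact: pclosed_porbit.
by rewrite -(porbit_agree _ (@rev_perm_out s j)) ?inE //; apply: pclosedC; exact: pclosed_porbit.
Qed.

Lemma rev_permK j : involutive (fun s => rev_perm s j).
Proof.
move=> s; apply/permP => x; rewrite rev_permE porbit_rev; case: ifP => xj; last first.
  by rewrite rev_permE xj.
apply: (@perm_inj _ (rev_perm s j)); rewrite permKV rev_permE porbit_permr xj.
by rewrite permK.
Qed.

Lemma odd_rev s j : rev_perm s j = s :> bool.
Proof.
by rewrite /odd_perm /porbits (eq_imset (g := porbit s)) // => x; apply: porbit_rev.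
Qed.

Lemma perm_on_rev s j A : perm_on A (rev_perm s j) = perm_on A s.
Proof.
have imp t : perm_on A t -> perm_on A (rev_perm t j).
  move=> At; apply/perm_onP => x xA; rewrite rev_permE !(out_perm _ xA) ?if_same //.
  exact: perm_onV.
by apply/idP/idP => [/imp|/imp //]; rewrite rev_permK.
Qed.

End PermOrbits.

(** Applying the orbit count [porbits_mul_tperm] to [s^-1] and to its product with the transposition
    shows that exactly one of the two memberships holds. Inverses turn right multiplication into the
    left multiplication of that formula. *)
Lemma porbit_mul_tperm (T : finType) (s : {perm T}) (i j : T) :
  i != j -> (j \in porbit (s * tperm i j)%g i) = (j \notin porbit s i).
Proof.
move=> ij; rewrite -(porbitV s) -(porbitV (s * _)%g) invMg tpermV ![j \in _]porbit_sym.
have /= := porbits_mul_tperm s^-1 i j; have /= := porbits_mul_tperm (tperm i j * s^-1) i j.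
rewrite mulgA tperm2 mul1g ij; move: #|porbits _| #|porbits _| => a b.
do 2!case: (i \in _) => //=; rewrite ?addn0 ?double0; clear; lia.
Qed.

(** * Merging two cycles by a transposition *)

Section Merge.
Variables (T : finType) (s : {perm T}) (i j : T).
Hypotheses (ij : i != j) (jNi : j \notin porbit s i).
Local Notation s' := (s * tperm i j)%g.
Local Notation U := (porbit s i :|: porbit s j).

Lemma porbits_disj x : x \in porbit s i -> x \in porbit s j -> False.
Proof.
rewrite -!eq_porbit_mem => /eqP xi /eqP xj; case/negP: jNi.
by rewrite -xi xj porbit_id.
Qed.

Lemma merge_out : {in ~: U, s =1 s'}.
Proof.
move=> x; rewrite !inE negb_or -(porbit_permr s i) -(porbit_permr s j) => /andP[xi xj].
by rewrite permM tpermD //; [apply: contraNneq xi => <-|apply: contraNneq xj => <-]; exact: porbit_id.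
Qed.

(** The transposition acts after [s], so a step changes only if it would land on [i] or [j]; the
    cycle of [i] avoids [j] and does not return to [i] this early. *)
Lemma mergeX_i k : (k < #|porbit s i|)%N -> (s' ^+ k)%g i = (s ^+ k)%g i.
Proof.
elim: k => [|k IH] ka; first by rewrite !expg0.
rewrite !permXS IH ?(ltnW ka) // permM tpermD //; rewrite -permXS eq_sym.
  by rewrite permX_neq.
by apply: contraNneq jNi => <-; exact: mem_porbit.
Qed.

Lemma mergeX_j k : (k < #|porbit s j|)%N -> (s' ^+ k)%g j = (s ^+ k)%g j.
Proof.
elim: k => [|k IH] ka; first by rewrite !expg0.
rewrite !permXS IH ?(ltnW ka) // permM tpermD //; rewrite -permXS eq_sym.
  by apply/eqP => e; apply: (porbits_disj (porbit_id s i)); rewrite -e mem_porbit.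
by rewrite permX_neq.
Qed.

Lemma mergeX_ij : (s' ^+ #|porbit s i|)%g i = j.
Proof.
rewrite -(prednK (card_porbit_gt0 s i)) permXS mergeX_i ?prednK ?card_porbit_gt0 //.
by rewrite permX_pred permM permKV tpermL.
Qed.

Lemma porbit_merge : porbit s' i = U.
Proof.
apply/eqP; rewrite eqEsubset; apply/andP; split.
  apply: porbit_sub; last by rewrite inE porbit_id.
  move=> x; rewrite permM !inE => xU.
  case: tpermP => [_|_|_ _]; rewrite ?porbit_id ?orbT //.
  by rewrite !porbit_permr.
have ji : j \in porbit s' i by apply/porbitP; exists #|porbit s i|; rewrite mergeX_ij.
rewrite subUset; apply/andP; split; apply/subsetP => x /porbit_lt[k ka ->].
  by rewrite -mergeX_i // mem_porbit.
rewrite -mergeX_j //; move: ji; rewrite -eq_porbit_mem => /eqP<-.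
exact: mem_porbit.
Qed.

Lemma card_porbit_merge : #|porbit s' i| = (#|porbit s i| + #|porbit s j|)%N.
Proof.
rewrite porbit_merge cardsU [_ :&: _](_ : _ = set0) ?cards0 ?subn0 //.
by apply/setP => x; rewrite !inE; apply/negP => /andP[]; exact: porbits_disj.
Qed.

Lemma mergeV_i : (s'^-1)%g i = (s^-1)%g j.
Proof. by apply: (@perm_inj _ s'); rewrite permKV permM permKV tpermR. Qed.

Lemma odd_merge : s' = ~~ s :> bool.
Proof. by rewrite odd_permM odd_tperm ij addbT. Qed.

End Merge.

(** * Walks along a permutation *)

Section Walks.
Variables (R : realType) (n : nat).
Local Notation H := (quat R).
Implicit Types (F G : 'M[H]_n) (s t : 'S_n) (A b : {set 'I_n}) (x y i j : 'I_n).

Definition walk F s x l : H := \prod_(k < l) F ((s ^+ k)%g x) ((s ^+ k.+1)%g x).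
(** The cycle product at [x] without its closing factor, which is its only entry from column [x]. *)
Definition owalk F s x : H := walk F s x #|porbit s x|.-1.
(** Each cycle has one least element, so for a union [A] of cycles every cycle counts once. *)
Definition eprod F s A : R := \prod_(x in A | cycmin s x) q0 (cycprod F s x).

Lemma walk0 F s x : walk F s x 0 = 1. Proof. exact: big_ord0. Qed.
Lemma walkS F s x l :
  walk F s x l.+1 = walk F s x l * F ((s ^+ l)%g x) ((s ^+ l.+1)%g x).
Proof. exact: big_ord_recr. Qed.
Lemma walkSl F s x l : walk F s x l.+1 = F x (s x) * walk F s (s x) l.
Proof.
rewrite /walk big_ord_recl expg0 perm1 expg1; congr (_ * _).
by apply: eq_bigr => k _; rewrite !lift0 -!permXSl.
Qed.
Lemma walkD F s x k l :
  walk F s x (k + l) = walk F s x k * walk F s ((s ^+ k)%g x) l.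
Proof.
elim: l => [|l IH]; first by rewrite addn0 walk0 mulr1.
by rewrite addnS !walkS IH mulrA -!permM -!expgD addnS.
Qed.

Lemma eq_walk F G s t x l :
  (forall k, (k <= l)%N -> (s ^+ k)%g x = (t ^+ k)%g x) ->
  (forall k, (k < l)%N -> let y := (s ^+ k)%g x in F y (s y) = G y (s y)) ->
  walk F s x l = walk G t x l.
Proof.
move=> st FG; apply: eq_bigr => k _.
by rewrite -!st ?(ltn_ord k) // ?(ltnW (ltn_ord k)) // permXS FG.
Qed.

Lemma cycprod_walk F s x : cycprod F s x = walk F s x #|porbit s x|.
Proof. by []. Qed.

Lemma cycprodE F s x : cycprod F s x = owalk F s x * F ((s^-1)%g x) x.
Proof.
rewrite cycprod_walk -(prednK (card_porbit_gt0 s x)) walkS /= -/(owalk _ _ _).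
by rewrite prednK ?card_porbit_gt0 // permX_pred permX_porbit.
Qed.

(** Changing the base point rotates the product cyclically, which preserves the real part. *)
Lemma q0_cycprod_porbit F s x y :
  y \in porbit s x -> q0 (cycprod F s y) = q0 (cycprod F s x).
Proof.
case/porbitP=> k ->; elim: k => [|k IH]; first by rewrite expg0 perm1.
rewrite permXS -IH; move: ((s ^+ k)%g x) => z; rewrite !cycprod_walk.
have -> : porbit s (s z) = porbit s z by rewrite -(porbit_perm s 1 z) expg1.
have NK := prednK (card_porbit_gt0 s z); rewrite -NK walkS walkSl q0M_comm -permXSl.
by rewrite -permXSl NK permXS !permX_porbit.
Qed.

(** Conjugation reverses the order of the factors, and each conjugated entry is the entry of [G] for
    the backward step. Taking [G] different from [F] also covers a matrix and its adjoint. *)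
Lemma qconj_walk F G s x l :
  (forall k, let y := (s ^+ k)%g x in G (s y) y = qconj (F y (s y))) ->
  qconj (walk F s x l) = walk G s^-1 ((s ^+ l)%g x) l.
Proof.
move=> Fh; elim: l => [|l IH]; first by rewrite !walk0 qconj1.
by rewrite walkS walkSl qconjM IH permXS permK Fh.
Qed.

Lemma eq_cycprod F G s t A x :
  pclosed s A -> {in A, s =1 t} -> {in A, forall y, F y (s y) = G y (s y)} ->
  x \in A -> cycprod F s x = cycprod G t x.
Proof.
move=> As st FG xA; rewrite !cycprod_walk -(porbit_agree As st xA).
apply: eq_walk => k _; first exact: permX_agree st xA.
by move=> /=; rewrite FG // pclosedX.
Qed.

Lemma eq_eprod F G s t A :
  pclosed s A -> {in A, s =1 t} -> {in A, forall y, F y (s y) = G y (s y)} ->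
  eprod F s A = eprod G t A.
Proof.
move=> As st FG; apply: eq_big => [x|x /andP[xA _]].
  case: (boolP (x \in A)) => //= xA.
  by rewrite /cycmin (porbit_agree As st xA).
by rewrite (eq_cycprod As st FG).
Qed.

Lemma cycmin_exists s j : exists2 x, x \in porbit s j & cycmin s x.
Proof.
case: (@arg_minnP _ j (fun x => x \in porbit s j) val (porbit_id s j)) => x xj xmin.
exists x => //; apply/'forall_implyP => y; have /eqP-> : porbit s x == porbit s j by rewrite eq_porbit_mem.
exact: xmin.
Qed.

Lemma cycmin_uniq s x y : cycmin s x -> cycmin s y -> x \in porbit s y -> x = y.
Proof.
move=> /'forall_implyP xm /'forall_implyP ym xy; apply/val_inj/eqP.
by rewrite eqn_leq xm 1?porbit_sym // ym.
Qed.

Lemma eprodD F s A j :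
  porbit s j \subset A ->
  eprod F s A = q0 (cycprod F s j) * eprod F s (A :\: porbit s j).
Proof.
move=> /subsetP jA; have [x xj xm] := cycmin_exists s j.
rewrite /eprod (bigD1 x) ?jA //= (q0_cycprod_porbit _ xj); congr (_ * _).
apply: eq_bigl => y; rewrite inE.
have [yj|] := boolP (y \in porbit s j); last first.
  move=> yj; rewrite /=; have -> : y != x by apply: contraNneq yj => ->.
  by rewrite andbT.
rewrite /=; apply/negP => /andP[/andP[_ ym] /eqP[]].
apply: (cycmin_uniq ym xm); move: xj yj.
by rewrite -!eq_porbit_mem => /eqP-> /eqP->.
Qed.

(** The merged cycle runs through the cycle of [i], lands on [j] where it would have closed up, and
    continues along the cycle of [j]. *)
Lemma owalk_merge F s i j : i != j -> j \notin porbit s i ->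
  owalk F (s * tperm i j)%g i = owalk F s i * F ((s^-1)%g i) j * owalk F s j.
Proof.
move=> ij jNi; rewrite /owalk card_porbit_merge //.
have ai := prednK (card_porbit_gt0 s i); have aj := prednK (card_porbit_gt0 s j).
rewrite -{1}aj addnS walkD mergeX_ij //; congr (_ * _); last first.
  by apply: eq_walk => // k kj; apply: mergeX_j => //; rewrite -[ltnRHS]aj ltnS.
rewrite -[in LHS]ai walkS ai mergeX_ij // mergeX_i //; last by rewrite -[ltnRHS]ai.
rewrite permX_pred //; congr (_ * _).
by apply: eq_walk => // k ki; apply: mergeX_i => //; rewrite -[ltnRHS]ai ltnS.
Qed.

End Walks.

(** * Replacing cycles by their real parts *)

Section Reversal.
Variables (R : realType) (n : nat).
Local Notation H := (quat R).
Implicit Types (F G : 'M[H]_n) (s t : 'S_n) (A b : {set 'I_n}) (x y i j : 'I_n).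

Lemma cycmin_rev s j x : cycmin (rev_perm s j) x = cycmin s x.
Proof. by rewrite /cycmin porbit_rev. Qed.

Lemma cycprod_rev_out F s j x :
  x \notin porbit s j -> cycprod F (rev_perm s j) x = cycprod F s x.
Proof.
move=> xj; apply/esym; apply: (@eq_cycprod _ _ F F s _ (~: porbit s j)); rewrite ?inE //.
- by apply: pclosedC; exact: pclosed_porbit.
- exact: rev_perm_out.
Qed.

Lemma cycprod_rev F s j :
  {in porbit s j, forall y, F (s y) y = qconj (F y (s y))} ->
  cycprod F (rev_perm s j) j = qconj (cycprod F s j).
Proof.
move=> Fh; rewrite [in RHS]cycprod_walk (qconj_walk (G := F)); last first.
  by move=> k y; apply: Fh; exact: mem_porbit.
rewrite permX_porbit -porbitV -cycprod_walk; apply/esym.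
apply: (@eq_cycprod _ _ F F _ _ (porbit s j)); rewrite ?porbit_id //.
- by apply: pclosedV; exact: pclosed_porbit.
- exact: rev_perm_in.
Qed.

Lemma q0_cycprod_rev F s j x :
  {in porbit s j, forall y, F (s y) y = qconj (F y (s y))} ->
  q0 (cycprod F (rev_perm s j) x) = q0 (cycprod F s x).
Proof.
move=> Fh; have [xj|xj] := boolP (x \in porbit s j); last by rewrite cycprod_rev_out.
rewrite (q0_cycprod_porbit F xj).
have {}xj : x \in porbit (rev_perm s j) j by rewrite porbit_rev.
by rewrite (q0_cycprod_porbit F xj) cycprod_rev // q0_conj.
Qed.

Lemma eprod_rev F s j A :
  {in porbit s j, forall y, F (s y) y = qconj (F y (s y))} ->
  eprod F (rev_perm s j) A = eprod F s A.
Proof.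
move=> Fh; apply: eq_big => [x|x _]; first by rewrite cycmin_rev.
exact: q0_cycprod_rev.
Qed.

(** Adding the sum to its reindexing by [rev_perm] replaces each cycle product by twice its real
    part. Invariant factors are allowed on both sides since they need not commute with it. *)
Lemma sum_rev F j (P : pred 'S_n) (f g : 'S_n -> H) :
  (forall s, P (rev_perm s j) = P s) ->
  (forall s, P s -> [/\ f (rev_perm s j) = f s, g (rev_perm s j) = g s &
      cycprod F (rev_perm s j) j = qconj (cycprod F s j)]) ->
  \sum_(s | P s) f s * cycprod F s j * g s =
  \sum_(s | P s) f s * qreal (q0 (cycprod F s j)) * g s.
Proof.
move=> Pr fg; apply: addrr_inj.
rewrite {2}(reindex_inj (inv_inj (rev_permK j))) (eq_bigl _ _ Pr) -!big_split /=.
apply: eq_bigr => s /fg[-> -> ->].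
rewrite -[LHS]mulrDl -[RHS]mulrDl; congr (_ * _).
by rewrite -[LHS]mulrDr -[RHS]mulrDr qaddConj mulr2n rmorphD.
Qed.

Lemma cycsignE s : cycsign R s = qreal ((-1) ^+ s).
Proof.
rewrite /cycsign rmorphXn rmorphN1 /odd_perm card_ord -signr_odd oddB //.
rewrite -[leqRHS]card_ord; exact: leq_imset_card.
Qed.

(** Induction on the list of base points: once the leading factor is real it commutes and is
    absorbed into [Y], which stays invariant under reversals. [G] may fail to be Hermitian in the
    row and column of [x0]. *)
Lemma sum_cyc_real G x0 (l : seq 'I_n) (Y : 'S_n -> H) :
  (forall x y, x != x0 -> y != x0 -> G y x = qconj (G x y)) -> uniq l ->
  (forall s j, j \notin porbit s x0 -> Y (rev_perm s j) = Y s) ->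
  \sum_s (\prod_(x <- l | (x \notin porbit s x0) && cycmin s x) cycprod G s x) * Y s =
  \sum_s qreal (\prod_(x <- l | (x \notin porbit s x0) && cycmin s x)
                 q0 (cycprod G s x)) * Y s.
Proof.
move=> Gh; have Gj s j : j \notin porbit s x0 ->
    {in porbit s j, forall y, G (s y) y = qconj (G y (s y))}.
  move=> jx y yj; have ne z : z \in porbit s j -> z != x0.
    by move=> zj; apply: contraNneq jx => <-; rewrite porbit_sym.
  by apply: Gh; apply: ne; rewrite ?porbit_permr.
elim: l Y => [|x l IH] Y /= => [_ _|/andP[xl ul] Yr].
  by apply: eq_bigr => s _; rewrite !big_nil.
pose P s := (x \notin porbit s x0) && cycmin s x.
(* The real factor due to [x], or 1 when [x] represents no cycle. *)
pose c s : H := if P s then qreal (q0 (cycprod G s x)) else 1.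
have cC s a : c s * a = a * c s.
  by rewrite /c; case: ifP => _; rewrite ?qreal_comm ?mulr1 ?mul1r.
have Pr s : P (rev_perm s x) = P s by rewrite /P porbit_rev cycmin_rev.
transitivity (\sum_s (\prod_(x <- l | (x \notin porbit s x0) && cycmin s x)
                        cycprod G s x) * (c s * Y s)); last first.
  rewrite IH // => [|s j jx]; last first.
    rewrite Yr // /c /P porbit_rev cycmin_rev; case: ifP => // _.
    by rewrite q0_cycprod_rev //; exact: Gj.
  apply: eq_bigr => s _; rewrite big_cons /c /P; case: ifP => _; rewrite ?mul1r //.
  by rewrite rmorphM mulrA (qreal_comm _ (qreal _)).
under [RHS]eq_bigr do rewrite mulrA -cC -mulrA.
under eq_bigr do rewrite big_cons.
rewrite (bigID P) [RHS](bigID P) /=; congr (_ + _); last first.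
  by apply: eq_bigr => s /negPf Ps; rewrite /c -/(P s) Ps mul1r.
under eq_bigr => s Ps do rewrite -/(P s) Ps -mulrA -[cycprod _ _ _]mul1r.
under [RHS]eq_bigr => s Ps do rewrite /c Ps -[qreal _]mul1r.
apply: (sum_rev (f := fun=> 1)) => // s Ps; split=> //; last first.
  by apply: cycprod_rev; apply: Gj; case/andP: Ps.
rewrite Yr; last by case/andP: Ps.
congr (_ * _); rewrite big_seq_cond [RHS]big_seq_cond.
apply: eq_big => [y|y]; first by rewrite porbit_rev cycmin_rev.
rewrite porbit_rev cycmin_rev => /and3P[yl yx0 ym]; apply: cycprod_rev_out.
(* Two least elements of one cycle coincide, and [x] does not occur in [l]; the other factors are
   therefore untouched by the reversal. *)
apply: contra xl => yx; case/andP: Ps => _ xm.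
by rewrite -(cycmin_uniq ym xm yx).
Qed.

(** The cycle through [x0] keeps its quaternion value, so column [x0] of [G] may be arbitrary, as
    after a column replacement. *)
Lemma cdet_real G x0 :
  (forall x y, x != x0 -> y != x0 -> G y x = qconj (G x y)) ->
  cdet x0 G =
  \sum_(s : 'S_n) qreal ((-1) ^+ s * eprod G s (~: porbit s x0)) * cycprod G s x0.
Proof.
move=> Gh; rewrite /cdet.
transitivity (\sum_(s : 'S_n) (\prod_(x <- rev (enum 'I_n) | (x \notin porbit s x0) && cycmin s x)
   cycprod G s x) * (qreal ((-1) ^+ s) * cycprod G s x0)).
  by apply: eq_bigr => s _; rewrite cycsignE mulrA qreal_comm mulrA.
rewrite sum_cyc_real ?rev_uniq ?enum_uniq // => [|s j jx].
  apply: eq_bigr => s _; rewrite mulrA -rmorphM mulrC; congr (qreal (_ * _) * _).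
  rewrite (perm_big _ (permEl (perm_rev _))) /= big_enum_cond.
  by apply: eq_bigl => x; rewrite !inE.
by rewrite odd_rev cycprod_rev_out // porbit_sym.
Qed.

End Reversal.

(** * Cofactors of principal submatrices of a Hermitian matrix *)

Section RealDet.
Variables (R : realType) (n : nat) (F : 'M[quat R]_n).
Local Notation H := (quat R).
Implicit Types (s t : 'S_n) (b : {set 'I_n}) (x y i j : 'I_n).

(* [pcof b i y] is the coefficient of the [y]th entry of the vector substituted for
   column [i] in [cdet_i] of the principal submatrix on [b]; cycles avoiding [i] enter
   through their real parts only. *)
Definition pdet b : R := \sum_(s : 'S_n | perm_on b s) (-1) ^+ s * eprod F s b.
Definition pcof b i y : H :=
  \sum_(s : 'S_n | perm_on b s && (s y == i))
    qreal ((-1) ^+ s * eprod F s (b :\: porbit s i)) * owalk F s i.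

(** Each [s] contributes to a single [y], the preimage of [i]. *)
Lemma pcof_mul b i (c : 'I_n -> H) :
  \sum_y pcof b i y * c y =
  \sum_(s : 'S_n | perm_on b s) qreal ((-1) ^+ s * eprod F s (b :\: porbit s i)) *
     (owalk F s i * c ((s^-1)%g i)).
Proof.
under eq_bigr do rewrite mulr_suml.
rewrite (exchange_big_dep (perm_on b)) /= => [|y s _ /andP[]//].
apply: eq_bigr => s bs; rewrite (big_pred1 ((s^-1)%g i)) ?mulrA // => y.
by rewrite bs /= (canF_eq (permK s)).
Qed.

Lemma pcof_out b i y : i \in b -> y \notin b -> pcof b i y = 0.
Proof.
move=> ib yb; rewrite /pcof big1 // => s /andP[bs /eqP sy].
by move: yb; rewrite -(perm_closed y bs) sy ib.
Qed.

Lemma pcof_diag b i : i \in b -> pcof b i i = qreal (pdet (b :\ i)).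
Proof.
move=> ib; rewrite /pcof /pdet rmorph_sum; apply: eq_big => s.
  apply/andP/perm_onP => [[/perm_onP bs /eqP si] x|bs].
    by rewrite !inE negb_and negbK; case/orP => [/eqP->//|/bs].
  split; last by rewrite bs ?setD11.
  by apply/perm_onP => x xb; apply: bs; rewrite !inE (negPf xb) andbF.
case/andP=> _ /eqP /porbit_fix si.
by rewrite /owalk si cards1 walk0 mulr1.
Qed.

(** Multiplying [s] by the transposition inserts [j] just before [i] in the cycle of [i]: the sign
    changes and the open walk gains the entry from the preimage of [i] to [j]. *)
Lemma pcof_border b i j : i \in b -> j \notin b ->
  pcof (j |: b) i j = - \sum_y pcof b i y * F y j.
Proof.
move=> ib jb; have ij : i != j by apply: contraNneq jb => <-.
rewrite pcof_mul -sumrN /pcof (reindex_inj (mulIg (tperm i j))) /=.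
have pon s : perm_on (j |: b) (s * tperm i j)%g && ((s * tperm i j)%g j == i) = perm_on b s.
  apply/andP/perm_onP => [[/perm_onP bs /eqP]|bs].
    rewrite permM => sj; have {}sj : s j = j by rewrite -[LHS](tpermK i j) sj tpermL.
    move=> x xb; have [->//|xj] := eqVneq x j.
    have := bs x; rewrite !inE negb_or xj xb => /(_ isT); rewrite permM => e.
    have ix : i != x by apply: contraNneq xb => <-.
    by rewrite -[LHS](tpermK i j) e tpermD // eq_sym.
  split; last by rewrite permM bs // tpermR.
  apply/perm_onP => x; rewrite !inE negb_or => /andP[xj xb]; rewrite permM bs //.
  by rewrite tpermD // 1?eq_sym //; apply: contraNneq xb => ->.
rewrite (eq_bigl _ _ pon); apply: eq_bigr => s bs.
have jNi : j \notin porbit s i.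
  by rewrite porbit_sym porbit_fix ?(out_perm bs) // inE.
have sj : porbit s j = [set j] by rewrite porbit_fix ?(out_perm bs).
rewrite odd_merge // owalk_merge // {2}/owalk sj cards1 walk0 mulr1.
rewrite -mulNr -rmorphN -mulNr; congr (qreal (_ * _) * _).
  by case: (s : bool) => /=; rewrite ?opprK.
have -> : (j |: b) :\: porbit (s * tperm i j) i = b :\: porbit s i.
  rewrite porbit_merge // sj; apply/setP => x; rewrite !inE negb_or.
  by have [->|xj] := eqVneq x j; rewrite /= ?(negPf jb) ?andbF ?andbT.
apply/esym/eq_eprod => // [|x].
  by apply: pclosedD; [exact: perm_on_pclosed|exact: pclosed_porbit].
rewrite inE => /andP[xi xb]; apply: merge_out => //.
rewrite !inE (negPf xi) /= sj inE; by apply: contraNneq jb => <-.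
Qed.

Hypothesis Fh : forall x y, F y x = qconj (F x y).

(** Column [i] of [F] itself closes the walk to a full cycle product, which reversal makes real. *)
Lemma pcof_col b i : i \in b -> \sum_y pcof b i y * F y i = qreal (pdet b).
Proof.
move=> ib; rewrite pcof_mul.
under eq_bigr do rewrite -cycprodE -[_ * cycprod _ _ _]mulr1.
rewrite (sum_rev (g := fun=> 1)) => [|s|s bs]; last 2 first.
- exact: perm_on_rev.
- by split=> //; [rewrite odd_rev porbit_rev eprod_rev|apply: cycprod_rev].
rewrite /pdet rmorph_sum; apply: eq_bigr => s bs.
rewrite mulr1 -rmorphM [in RHS](eprodD _ (j := i)).
  by rewrite -mulrA [q0 _ * _]mulrC.
by apply: porbit_sub => //; exact: perm_on_pclosed.
Qed.

(* Right multiplication by the transposition [(i j)] exchanges the permutations whose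
   cycle through [i] avoids [j] with those whose cycle through [i] meets [j]. *)
Lemma pcof_col_neq b i j : i \in b -> j \in b -> i != j ->
  \sum_y pcof b i y * F y j = 0.
Proof.
move=> ib jb ij; rewrite pcof_mul (bigID (fun s => j \in porbit s i)) /=.
(* For [j] off the cycle of [i], this collects everything except the cycle of [j]. *)
pose f s : H := qreal ((-1) ^+ s * eprod F s (b :\: porbit s i :\: porbit s j)) *
   (owalk F s i * F ((s^-1)%g i) j).
have bcl s : perm_on b s -> pclosed s (b :\: porbit s i).
  by move=> bs; apply: pclosedD; [exact: perm_on_pclosed|exact: pclosed_porbit].
have pon s : perm_on b (s * tperm i j)%g = perm_on b s.
  have tb : perm_on b (tperm i j).
    by apply/perm_onP => x xb; rewrite tpermD //; apply: contraNneq xb => <-.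
  apply/idP/idP => bs; last exact: perm_onM.
  by rewrite -[s](mulgK (tperm i j)) tpermV; exact: perm_onM.
(* Reversal used backwards: the real part of the cycle of [j] becomes the full product again, placed
   last to match the merged walk. *)
have -> : \sum_(s : 'S_n | perm_on b s && (j \notin porbit s i))
    qreal ((-1) ^+ s * eprod F s (b :\: porbit s i)) * (owalk F s i * F (s^-1 i)%g j) =
    \sum_(s : 'S_n | perm_on b s && (j \notin porbit s i)) f s * cycprod F s j.
  under [RHS]eq_bigr do rewrite -[_ * cycprod _ _ _]mulr1.
  rewrite (sum_rev (g := fun=> 1)) => [|s|s /andP[bs js]]; last 2 first.
  - by rewrite perm_on_rev porbit_rev.
  - split=> //; last by apply: cycprod_rev.
    rewrite /f odd_rev !porbit_rev eprod_rev //; congr (_ * _).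
    rewrite -(permX_pred s) -(permX_pred (rev_perm s j)) /owalk porbit_rev.
    have ag k : (rev_perm s j ^+ k)%g i = (s ^+ k)%g i.
      have cl := pclosedC (@pclosed_porbit _ s j).
      by rewrite (permX_agree k cl (@rev_perm_out _ s j)) ?inE // porbit_sym.
    rewrite ag; congr (_ * _); by apply: eq_walk => // k _; exact: ag.
  apply: eq_bigr => s /andP[bs js]; rewrite mulr1 /f -mulrA -[X in _ = _ * X]qreal_comm.
  rewrite [RHS]mulrA -rmorphM (eprodD _ (j := j)); last first.
    by apply: porbit_sub; [exact: bcl|rewrite inE js].
  by rewrite -mulrA [q0 _ * _]mulrC.
rewrite (reindex_inj (mulIg (tperm i j))) /=.
rewrite (eq_bigl (fun s => perm_on b s && (j \notin porbit s i))) => [|s]; last first.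
  by rewrite pon porbit_mul_tperm.
rewrite -big_split big1 //= => s /andP[bs js].
rewrite odd_merge // mergeV_i.
have -> : eprod F (s * tperm i j) (b :\: porbit (s * tperm i j) i) =
          eprod F s (b :\: porbit s i :\: porbit s j).
  rewrite porbit_merge // -setDDl; apply/esym/eq_eprod => // [|x].
    by apply: pclosedD; [exact: bcl|exact: pclosed_porbit].
  by rewrite !inE => /and3P[xj xi xb]; apply: merge_out => //; rewrite !inE negb_or xi.
(* Both terms now carry the same quaternion product, with opposite signs. *)
rewrite /f cycprodE owalk_merge // -!mulrA -mulrDl -rmorphD -mulrDl.
by case: (s : bool); rewrite /= ?addrN ?addNr mul0r rmorph0 mul0r.
Qed.

End RealDet.

(** * Principal submatrices *)

Section Extension.
Variables (n : nat) (b : {set 'I_n}).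
Local Notation f := (@enum_val _ (mem b)).
Implicit Types (s t : {perm 'I_#|b|}).

(** Moves permutations of the positions in [b] into the full symmetric group, where minors on
    different sets [b] can be compared. *)
Definition ext_fun s x : 'I_n :=
  if [pick k | f k == x] is Some k then f (s k) else x.

Lemma ext_fun_in s k : ext_fun s (f k) = f (s k).
Proof.
rewrite /ext_fun; case: pickP => [l /eqP/enum_val_inj->//|/(_ k)].
by rewrite eqxx.
Qed.

Lemma ext_fun_out s x : x \notin b -> ext_fun s x = x.
Proof.
rewrite /ext_fun; case: pickP => // k /eqP<-.
by rewrite enum_valP.
Qed.

Lemma enum_val_ex x : x \in b -> exists k, x = f k.
Proof. by move=> xb; exists (enum_rank_in xb x); rewrite enum_rankK_in. Qed.

Fact ext_fun_inj s : injective (ext_fun s).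
Proof.
move=> x y; have [/enum_val_ex[k ->]|xb] := boolP (x \in b);
  have [/enum_val_ex[l ->]|yb] := boolP (y \in b); rewrite ?ext_fun_in ?ext_fun_out //.
- by move/enum_val_inj/perm_inj->.
- by move=> e; rewrite -e enum_valP in yb.
- by move=> e; rewrite e enum_valP in xb.
Qed.

Definition ext_perm s : {perm 'I_n} := perm (@ext_fun_inj s).

Lemma ext_permE s k : ext_perm s (f k) = f (s k).
Proof. by rewrite permE ext_fun_in. Qed.

Lemma ext_perm_on s : perm_on b (ext_perm s).
Proof. by apply/perm_onP => x xb; rewrite permE ext_fun_out. Qed.

Lemma ext_perm_inj : injective ext_perm.
Proof.
by move=> s t /permP st; apply/permP => k; apply: (enum_val_inj (A := mem b)); rewrite -!ext_permE st.
Qed.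

Lemma ext_permM s t : ext_perm (s * t) = (ext_perm s * ext_perm t)%g.
Proof.
apply/permP => x; rewrite permM; have [/enum_val_ex[k ->]|xb] := boolP (x \in b).
  by rewrite !ext_permE permM.
by rewrite ![ext_perm _ x]permE !ext_fun_out // permE ext_fun_out.
Qed.

Lemma ext_perm_tperm k l : ext_perm (tperm k l) = tperm (f k) (f l).
Proof.
apply/permP => x; have [/enum_val_ex[h ->]|xb] := boolP (x \in b).
  by rewrite ext_permE inj_tperm //; exact: enum_val_inj.
by rewrite permE ext_fun_out // tpermD //; apply: contraNneq xb => <-; exact: enum_valP.
Qed.

(** Extension is multiplicative and maps transpositions to transpositions. *)
Lemma odd_ext s : ext_perm s = s :> bool.
Proof.
have [ts -> ds] := prod_tpermP s; elim: ts ds => [|[k l] ts IH] /=.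
  (* The extended identity equals its own square, hence is even. *)
  have := congr1 (@odd_perm _) (ext_permM 1 1).
  by rewrite big_nil mulg1 odd_permM addbb odd_perm1.
case/andP=> kl /IH e; rewrite big_cons ext_permM !odd_permM e ext_perm_tperm !odd_tperm /=.
by rewrite (inj_eq enum_val_inj).
Qed.

Lemma ext_permX s k l : (ext_perm s ^+ l)%g (f k) = f ((s ^+ l)%g k).
Proof. by elim: l => [|l IH]; rewrite ?expg0 ?perm1 // !permXS IH ext_permE. Qed.

Lemma porbit_ext s k : porbit (ext_perm s) (f k) = f @: porbit s k.
Proof.
apply/setP => x; apply/porbitP/imsetP => [[l ->]|[_ /porbitP[l ->] ->]].
  by exists ((s ^+ l)%g k); rewrite ?mem_porbit // ext_permX.
by exists l; rewrite ext_permX.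
Qed.

Lemma mem_porbit_ext s k l : (f l \in porbit (ext_perm s) (f k)) = (l \in porbit s k).
Proof. by rewrite porbit_ext mem_imset //; exact: enum_val_inj. Qed.

(** The enumeration of [b] filters a sorted one. Monotonicity is what carries least elements of
    cycles over to the submatrix. *)
Lemma ltn_enum_val (k l : 'I_#|b|) : (k < l)%N -> (f k < f l)%N.
Proof.
move=> kl; have x0 := f k; rewrite !(enum_val_nth x0).
have lt_tr : transitive (fun x y : 'I_n => (x < y)%N) by move=> x y z; exact: ltn_trans.
have lt_s : sorted (fun x y : 'I_n => (x < y)%N) (enum (mem b)).
  rewrite {1}/enum_mem; apply: sorted_filter => //; rewrite -enumT.
  by have := iota_ltn_sorted 0 n; rewrite -val_enum_ord sorted_map.
by apply: (sorted_ltn_nth lt_tr _ lt_s) => //; rewrite inE -cardE ltn_ord.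
Qed.

Lemma leq_enum_val (k l : 'I_#|b|) : (f k <= f l)%N = (k <= l)%N.
Proof.
apply/idP/idP => [|]; last first.
  by rewrite leq_eqVlt => /predU1P[/val_inj->//|/ltn_enum_val/ltnW].
by apply: contraTT; rewrite -!ltnNge; exact: ltn_enum_val.
Qed.

Lemma cycmin_ext s k : cycmin (ext_perm s) (f k) = cycmin s k.
Proof.
apply/'forall_implyP/'forall_implyP => km x.
  by move=> xk; rewrite -leq_enum_val km // mem_porbit_ext.
by rewrite porbit_ext => /imsetP[l /km kl ->]; rewrite leq_enum_val.
Qed.

(** Extension is injective into the permutations supported on [b], and both sets have [#|b|]
    factorial elements. *)
Lemma sum_ext (V : nmodType) (h : {perm 'I_n} -> V) :
  \sum_(t | perm_on b t) h t = \sum_s h (ext_perm s).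
Proof.
transitivity (\sum_(t in [set ext_perm s | s in setT]) h t); last first.
  rewrite big_imset => [|s t _ _]; last exact: ext_perm_inj.
  by apply: eq_bigl => s; rewrite inE.
apply: eq_bigl => t; apply/esym.
have E : [set ext_perm s | s in setT] \subset (@perm_on _ b).
  by apply/subsetP => _ /imsetP[s _ ->]; exact: ext_perm_on.
apply: (subset_cardP _ E); rewrite card_imset ?cardsT ?card_Sn ?card_perm //.
exact: ext_perm_inj.
Qed.

Variable R : realType.
Implicit Type F G : 'M[quat R]_n.

Lemma cycprod_ext G s k : cycprod G (ext_perm s) (f k) = cycprod (psub G b) s k.
Proof.
rewrite !cycprod_walk porbit_ext card_imset; last exact: enum_val_inj.
by apply: eq_bigr => l _; rewrite !ext_permX mxE.
Qed.

Lemma eprod_ext G s (A : {set 'I_#|b|}) : eprod G (ext_perm s) (f @: A) = eprod (psub G b) s A.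
Proof.
rewrite /eprod big_imset_cond /=; last by move=> ? ? _ _; exact: enum_val_inj.
by apply: eq_big => [k|k _]; rewrite ?cycmin_ext ?cycprod_ext.
Qed.

Lemma imset_enum_val : f @: setT = b.
Proof.
apply/setP => x; apply/imsetP/idP => [[k _ ->]|/enum_val_ex[k ->]]; first exact: enum_valP.
by exists k.
Qed.

Lemma imset_enum_valC (A : {set 'I_#|b|}) : f @: (~: A) = b :\: f @: A.
Proof.
apply/setP => x; rewrite inE; have [/enum_val_ex[k ->]|xb] := boolP (x \in b).
  by rewrite !mem_imset ?inE ?andbT //; exact: enum_val_inj.
by rewrite andbF; apply: contraNF xb => /imsetP[k _ ->]; exact: enum_valP.
Qed.

Lemma pdet_psub F : pdet (psub F b) setT = pdet F b.
Proof.
rewrite /pdet sum_ext; apply: eq_big => [s|s _]; first by apply/perm_onP => x; rewrite inE.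
by rewrite odd_ext -eprod_ext imset_enum_val.
Qed.

Lemma cdet_psub G k :
  (forall x y, x != f k -> y != f k -> G y x = qconj (G x y)) ->
  cdet k (psub G b) = \sum_(t : 'S_n | perm_on b t)
    qreal ((-1) ^+ t * eprod G t (b :\: porbit t (f k))) * cycprod G t (f k).
Proof.
move=> Gh; rewrite sum_ext cdet_real => [|x y xk yk]; last first.
  by rewrite !mxE Gh // (inj_eq enum_val_inj).
apply: eq_bigr => s _.
by rewrite odd_ext porbit_ext -imset_enum_valC -eprod_ext -cycprod_ext.
Qed.

(** The replaced column is read only by the closing factor of the cycle through [i]; other cycles
    avoid [i], and the open walk has not yet returned to it. *)
Lemma cdet_sub_colrep F i (c : 'cV_n) : i \in b ->
  (forall x y, F y x = qconj (F x y)) ->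
  cdet_sub (colrep F i c) b i = \sum_y pcof F b i y * c y 0.
Proof.
move=> ib Fh; rewrite /cdet_sub; case: pickP => [k /eqP ki|]; last first.
  by have [k ->] := enum_val_ex ib; move/(_ k); rewrite eqxx.
rewrite cdet_psub ki => [|x y xi yi]; last by rewrite !mxE (negPf xi) (negPf yi).
rewrite pcof_mul; apply: eq_bigr => t bt; congr (qreal (_ * _) * _).
  apply: eq_eprod => // [|x].
    by apply: pclosedD; [exact: perm_on_pclosed|exact: pclosed_porbit].
  rewrite inE => /andP[xi xb]; rewrite mxE; case: eqP => // tx.
  by case/negP: xi; rewrite -porbit_permr tx porbit_id.
rewrite cycprodE mxE eqxx; congr (_ * _); apply: eq_walk => // k' ka y.
rewrite /y mxE -permXS ifN // permX_neq //.
by rewrite -(prednK (card_porbit_gt0 t i)) ltnS.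
Qed.

End Extension.

(** * Row determinants as conjugates of column determinants *)

Section Duality.
Variables (R : realType) (n : nat).
Implicit Types (F G : 'M[quat R]_n).

Lemma qconj_cycprod F s x : qconj (cycprod (adjq F) s x) = cycprod F s^-1 x.
Proof.
rewrite !cycprod_walk (qconj_walk (G := F)) ?porbitV ?permX_porbit // => k y.
by rewrite mxE qconjK.
Qed.

(** Conjugation reverses the order of the cycles and of the entries within each; passing to the
    inverse permutation restores the direction of the cycles. *)
Lemma rdet_cdet F i : rdet i F = qconj (cdet i (adjq F)).
Proof.
rewrite /rdet /cdet raddf_sum (reindex_inj invg_inj); apply: eq_bigr => s _ /=.
rewrite qconjM !cycsignE qconj_real odd_permV -qreal_comm qconjM.
rewrite qconj_cycprod qconj_prod revK porbitV; congr (_ * (_ * _)).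
have -> : enum 'I_n = index_enum 'I_n by rewrite enumT.
apply: eq_big => [x|x _]; last by rewrite qconj_cycprod.
by rewrite /cycmin !porbitV.
Qed.

End Duality.

Section DualSubmatrix.
Variables (R : realType) (n : nat).
Implicit Types (F G : 'M[quat R]_n).

Lemma adjq_psub F b : adjq (psub F b) = psub (adjq F) b.
Proof. by apply/matrixP => x y; rewrite !mxE. Qed.

Lemma rdet_sub_rowrep F j (c : 'rV_n) b :
  rdet_sub (rowrep F j c) b j = qconj (cdet_sub (colrep (adjq F) j (adjq c)) b j).
Proof.
rewrite /rdet_sub /cdet_sub; case: pickP => [k _|_]; last by rewrite raddf0.
rewrite rdet_cdet adjq_psub; congr (qconj (cdet k (psub _ b))).
by apply/matrixP => x y; rewrite !mxE; case: eqP.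
Qed.

End DualSubmatrix.

(** * Sums of principal minors and the cofactor matrices *)

Section HermitianMinors.
Variables (R : realType) (n : nat) (F : 'M[quat R]_n).
Hypothesis Fh : adjq F = F.

Lemma herm_entry x y : F y x = qconj (F x y).
Proof. by rewrite -[in LHS]Fh mxE. Qed.

Definition dsum k : R := \sum_(b : {set 'I_n} | #|b| == k) pdet F b.
(** The matrix called [T_k] in the overview; [dsum k] is [d_k]. *)
Definition cof k : 'M[quat R]_n :=
  \matrix_(i, y) \sum_(b : {set 'I_n} | (#|b| == k) && (i \in b)) pcof F b i y.

Lemma cdsumE k i c : cdsum F k i c = (cof k *m c) i 0.
Proof.
rewrite /cdsum mxE; under [RHS]eq_bigr do rewrite mxE mulr_suml.
rewrite exchange_big; apply: eq_bigr => b /andP[_ ib].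
by rewrite cdet_sub_colrep //; exact: herm_entry.
Qed.

Lemma rdsum_cdsum k j c : rdsum F k j c = qconj (cdsum F k j (adjq c)).
Proof.
rewrite /rdsum /cdsum raddf_sum; apply: eq_bigr => b _ /=.
by rewrite rdet_sub_rowrep Fh.
Qed.

Lemma cdet_pdet i : cdet i F = qreal (pdet F setT).
Proof.
rewrite cdet_real => [|x y _ _]; last exact: herm_entry.
rewrite -(pcof_col herm_entry (i := i)) ?inE // pcof_mul.
apply: eq_big => [s|s _]; first by apply/esym/perm_onP => x; rewrite inE.
by rewrite setTD -cycprodE.
Qed.

End HermitianMinors.

Lemma pdet0 (R : realType) n (F : 'M[quat R]_n) : pdet F set0 = 1.
Proof.
rewrite /pdet (big_pred1 1%g) => [|s]; last first.
  apply/perm_onP/eqP => [s1|-> x _]; last by rewrite perm1.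
  by apply/permP => x; rewrite perm1 s1 ?inE.
by rewrite odd_perm1 mul1r /eprod big1 // => x; rewrite inE.
Qed.

Lemma hdet_pdet (R : realType) n (F : 'M[quat R]_n) :
  adjq F = F -> hdet F = qreal (pdet F setT).
Proof.
case: n F => [F _|n F Fh] /=.
  (* In size 0 the determinant is 1 by convention, matching the single term of the identity
     permutation. *)
  by rewrite (_ : setT = set0) ?pdet0 //; apply/setP => -[].
by rewrite rdet_cdet Fh cdet_pdet // qconj_real.
Qed.

Lemma minsumE (R : realType) n (F : 'M[quat R]_n) k :
  adjq F = F -> minsum F k = qreal (dsum F k).
Proof.
move=> Fh; rewrite /minsum rmorph_sum; apply: eq_bigr => b _ /=.
by rewrite hdet_pdet ?adjq_psub ?Fh // pdet_psub.
Qed.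

(** * The adjugate recursion *)

Section AdjugateRecursion.
Variables (R : realType) (n : nat) (F : 'M[quat R]_n).
Hypothesis Fh : adjq F = F.
Local Notation d := (dsum F).
Local Notation T := (cof F).

Lemma dsum0 : d 0 = 1.
Proof.
rewrite /dsum (big_pred1 set0) ?pdet0 // => b; exact: cards_eq0.
Qed.

Lemma cof0 : T 0 = 0.
Proof.
apply/matrixP => i y; rewrite !mxE big1 // => b /andP[/eqP/cards0_eq-> ].
by rewrite inE.
Qed.

Lemma cof_oversize k : (n < k)%N -> T k = 0.
Proof.
move=> nk; apply/matrixP => i y; rewrite !mxE big1 // => b /andP[/eqP bk _].
by have := max_card (mem b); rewrite bk card_ord leqNgt nk.
Qed.

Lemma sum_add1 (V : nmodType) k (i : 'I_n) (P : pred {set 'I_n}) (h : {set 'I_n} -> V) :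
  \sum_(g : {set 'I_n} | [&& #|g| == k.+1, P g & i \in g]) h g =
  \sum_(b : {set 'I_n} | [&& #|b| == k, P (i |: b) & i \notin b]) h (i |: b).
Proof.
rewrite (reindex_onto (fun b => i |: b) (fun g => g :\ i)) /= => [|g]; last first.
  by case/and3P=> _ _; exact: setD1K.
apply: eq_bigl => b; rewrite setU11 andbT cardsU1.
have [ib|ib] := boolP (i \in b).
  rewrite !andbF; apply/negP => /andP[_ /eqP e].
  by move: (setD11 i (i |: b)); rewrite e ib.
by rewrite setU1K // eqxx !andbT add1n eqSS.
Qed.

Lemma cof_mulE k i j : (T k *m F) i j =
  \sum_(b : {set 'I_n} | (#|b| == k) && (i \in b)) \sum_y pcof F b i y * F y j.
Proof.
rewrite mxE exchange_big; apply: eq_bigr => y _.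
by rewrite mxE mulr_suml.
Qed.

Lemma cof_mul_diag k i :
  (T k *m F) i i = qreal (\sum_(b : {set 'I_n} | (#|b| == k) && (i \in b)) pdet F b).
Proof.
rewrite cof_mulE rmorph_sum; apply: eq_bigr => b /andP[_ ib].
by rewrite pcof_col //; exact: herm_entry.
Qed.

(** On the diagonal, [d k] minus the minors containing [i] leaves those avoiding [i], which are the
    diagonal cofactors one size up. Off the diagonal, sets containing [j] vanish in [T k *m F], and
    those avoiding [j] are bordered by [j]. *)
Lemma cofS k : T k.+1 = (qreal (d k))%:M - T k *m F.
Proof.
apply/matrixP => i j; rewrite [RHS]mxE [X in _ = _ + X]mxE [LHS]mxE.
rewrite [X in _ = X - _]mxE.
have [<-{j}|ij] := eqVneq i j.
  rewrite cof_mul_diag mulr1n -rmorphB /dsum [in RHS](bigID (fun b : {set _} => i \in b)) /=.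
  rewrite [X in qreal X]addrAC subrr add0r rmorph_sum /=.
  transitivity (\sum_(g : {set 'I_n} | [&& #|g| == k.+1, true & i \in g]) pcof F g i i).
    by [].
  rewrite (sum_add1 k i xpredT); apply: eq_bigr => b /andP[_ ib].
  by rewrite pcof_diag ?setU11 // setU1K.
rewrite mulr0n add0r cof_mulE.
rewrite (bigID (fun b : {set _} => j \in b)) /= [X in _ + X]big1 ?addr0; last first.
  by move=> b /andP[/andP[_ ib] jb]; rewrite pcof_out.
rewrite [in RHS](bigID (fun b : {set _} => j \in b)) /= [X in _ = - (X + _)]big1 ?add0r; last first.
  by move=> b /andP[/andP[_ ib] jb]; rewrite pcof_col_neq //; exact: herm_entry.
rewrite -sumrN.
transitivity (\sum_(g : {set 'I_n} | [&& #|g| == k.+1, i \in g & j \in g]) pcof F g i j).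
  by apply: eq_bigl => b; rewrite andbA.
rewrite (sum_add1 k j (fun g => i \in g)); apply: eq_big => [b|b /and3P[_]].
  by rewrite in_setU1 (negPf ij) andbA.
rewrite in_setU1 (negPf ij) /= => ib jb; rewrite pcof_border //.
Qed.

(** By the recursion [T k] is a polynomial in [F] with real coefficients. *)
Lemma cof_comm k : F *m T k = T k *m F.
Proof.
elim: k => [|k IH]; first by rewrite cof0 mulmx0 mul0mx.
rewrite cofS mulmxBr mulmxBl mul_qscalar_mx mul_mx_qscalar; congr (_ - _).
by rewrite mulmxA IH.
Qed.

Lemma adjq_cof k : adjq (T k) = T k.
Proof.
elim: k => [|k IH]; first by rewrite cof0 raddf0.
by rewrite cofS raddfB /= adjq_scalar adjqM Fh IH cof_comm.
Qed.

(** Each subset of size [k] is counted once for each of its elements. *)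
Lemma tr_cof k : q0 (\tr (T k *m F)) = k%:R * d k.
Proof.
rewrite /mxtrace raddf_sum /=; under eq_bigr do rewrite cof_mul_diag /=.
rewrite (exchange_big_dep (fun b : {set 'I_n} => #|b| == k)) /= => [|i b _ /andP[]//].
rewrite mulr_sumr; apply: eq_bigr => b /eqP bk.
rewrite (eq_bigl (mem b)) => [|i]; last by rewrite bk eqxx.
by rewrite sumr_const bk mulr_natl.
Qed.

Lemma rdsumE k j c : rdsum F k j c = (c *m T k) 0 j.
Proof.
by rewrite rdsum_cdsum // cdsumE // -[in LHS](adjq_cof k) -adjqM mxE qconjK.
Qed.

End AdjugateRecursion.

(** * Cofactors of [A^* A] and the Penrose equations *)

Section Gram.
Variables (R : realType) (m n : nat) (A : 'M[quat R]_(m, n)).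
Local Notation F := (adjq A *m A).
Local Notation d := (dsum F).
Local Notation T := (cof F).

Lemma adjq_gram : adjq F = F. Proof. by rewrite adjqM adjqK. Qed.
Local Notation Fh := adjq_gram.

Lemma gram_mul_eq0 p (X : 'M[quat R]_(n, p)) : F *m F *m X = 0 -> F *m X = 0.
Proof. by rewrite -{1}adjq_gram; exact: adjq_mul_eq0. Qed.

(* [T_{l+1} = - F T_l] as long as [d l = 0], and [F F X = 0] forces [F X = 0]. *)
Lemma gram_cof_eq0 k :
  (forall l, (k < l)%N -> d l = 0) -> F *m T k.+1 = 0.
Proof.
(* Descending induction on [j], starting beyond [n], where [T j] vanishes. *)
move=> d0; suff H l : forall j, (k < j)%N -> (n < j + l)%N -> F *m T j = 0.
  by apply: (H n.+1); [exact: ltnSn|rewrite addnS ltnS leq_addl].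
elim: l => [|l IH] j kj nj; first by rewrite cof_oversize ?mulmx0 // -(addn0 j).
have := IH j.+1 (ltnW kj); rewrite addSnnS => /(_ nj).
rewrite (cofS Fh) d0 // mulmxBr mul_mx_qscalar rmorph0 scale0r sub0r.
move/eqP; rewrite oppr_eq0 => /eqP FTF; apply: gram_mul_eq0.
by rewrite -mulmxA (cof_comm Fh).
Qed.

Lemma gram_cof k : (forall l, (k < l)%N -> d l = 0) ->
  F *m T k *m F = qreal (d k) *: F.
Proof.
move=> /gram_cof_eq0/eqP; rewrite (cofS Fh) mulmxBr mul_mx_qscalar subr_eq0.
by rewrite !mulmxA => /eqP->.
Qed.

Definition mpinv k := qreal (d k)^-1 *: (T k *m adjq A).

Lemma mpinvP k : (forall l, (k < l)%N -> d l = 0) -> d k != 0 -> is_MP A (mpinv k).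
Proof.
move=> d0 dk; have := gram_cof d0; rewrite !mulmxA => FTF.
(* Cancels [A^*] on the left of [F T F = d F]; the adjoint of the result is [FTA]. *)
have ATF : A *m (T k *m F) = qreal (d k) *: A.
  apply/eqP; rewrite -subr_eq0; apply/eqP.
  have -> : A *m (T k *m F) - qreal (d k) *: A = A *m (T k *m F - (qreal (d k))%:M).
    by rewrite mulmxBr mul_mx_qscalar.
  by apply: adjq_mul_eq0; rewrite mulmxBr mul_mx_qscalar !mulmxA FTF subrr.
have FTA : F *m T k *m adjq A = qreal (d k) *: adjq A.
  by have := congr1 (@adjq R _ _) ATF; rewrite adjqM adjqM Fh (adjq_cof Fh) adjq_scale.
rewrite /is_MP /mpinv; split.
- by rewrite qscaleAr -scalemxAl -!mulmxA ATF qscaleK.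
- rewrite -!scalemxAl !qscaleAr -!mulmxA.
  have -> : adjq A *m (A *m (T k *m adjq A)) = qreal (d k) *: adjq A by rewrite !mulmxA.
  by rewrite qscaleAr qscaleK.
- by rewrite qscaleAr adjq_scale adjqM [adjq (_ *m _)]adjqM adjqK (adjq_cof Fh) mulmxA.
- by rewrite -scalemxAl adjq_scale -mulmxA adjqM Fh (adjq_cof Fh) (cof_comm Fh).
Qed.
End Gram.

(** * Rank and the Moore-Penrose inverse *)

Section Intertwining.
Variables (R : realType) (m n : nat) (A : 'M[quat R]_(m, n)).
Local Notation d := (dsum (adjq A *m A)).
Local Notation d' := (dsum (A *m adjq A)).

Lemma adjq_cogram : adjq (A *m adjq A) = A *m adjq A.
Proof. by rewrite adjqM adjqK. Qed.

(** Only coefficients below [k] enter [T_k], so this can serve inside a strong induction proving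
    that they agree. *)
Lemma cof_intertwine k : (forall l, (l < k)%N -> d l = d' l) ->
  A *m cof (adjq A *m A) k = cof (A *m adjq A) k *m A.
Proof.
elim: k => [|k IH] dd; first by rewrite !cof0 mulmx0 mul0mx.
rewrite cofS ?adjq_gram // cofS ?adjq_cogram // mulmxBr mulmxBl dd //.
rewrite mul_mx_qscalar mul_qscalar_mx; congr (_ - _).
by rewrite [LHS]mulmxA IH ?mulmxA // => l lk; rewrite dd // ltnW.
Qed.

(* Newton's identity [tr_cof] determines the coefficients by the traces
   [Re tr (F^j)], which agree for [A^* A] and [A A^*]. *)
Lemma dsum_gramC k : d k = d' k.
Proof.
elim/ltn_ind: k => -[|k] IH; first by rewrite !dsum0.
have k0 : (k.+1)%:R != 0 :> R by rewrite pnatr_eq0.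
apply: (mulfI k0); rewrite -(tr_cof (adjq_gram A)) -(tr_cof adjq_cogram).
by rewrite mulmxA q0_trC mulmxA cof_intertwine // !mulmxA.
Qed.

End Intertwining.

(** * Positivity of principal minors of Gram matrices, and rank *)

Section Positivity.
Variable R : realType.
Local Notation H := (quat R).

Lemma dsum_full n (F : 'M[H]_n) : dsum F n = pdet F setT.
Proof.
rewrite /dsum (big_pred1 setT) // => b /=.
by rewrite eqEcard subsetT cardsT card_ord /= eqn_leq -[X in (_ <= X)%N]card_ord max_card.
Qed.

Lemma dsum_oversize n (F : 'M[H]_n) k : (n < k)%N -> dsum F k = 0.
Proof.
move=> nk; rewrite /dsum big_pred0 // => b; apply/eqP => bk.
by have := max_card (mem b); rewrite bk card_ord leqNgt nk.
Qed.

Lemma colsub_mul m n p (f : 'I_p -> 'I_n) (A : 'M[H]_(m, n)) (v : 'cV[H]_p) :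
  colsub f A *m v = A *m (colsub f 1%:M *m v).
Proof. by rewrite mulmxA mulmx_colsub mulmx1. Qed.

Lemma col_indep_colsub m n p (f : 'I_p -> 'I_n) (A : 'M[H]_(m, n)) :
  injective f -> col_indep A -> col_indep (colsub f A).
Proof.
move=> fi Ai v; rewrite colsub_mul => /Ai /colP e; apply/colP => k.
have := e (f k); rewrite !mxE (bigD1 k) //= big1 => [|l lk]; rewrite !mxE ?eqxx ?mul1r ?addr0 //.
by rewrite (inj_eq fi) eq_sym (negPf lk) mul0r.
Qed.

Lemma psub_gram m n (A : 'M[H]_(m, n)) (b : {set 'I_n}) :
  psub (adjq A *m A) b = adjq (colsub (fun k : 'I_#|b| => enum_val k) A) *m
    colsub (fun k : 'I_#|b| => enum_val k) A.
Proof. by apply/matrixP => i j; rewrite !mxE; apply: eq_bigr => k _; rewrite !mxE. Qed.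

(** The adjugate identity: the recursion at [n], where [T_{n+1} = 0]. *)
Lemma gram_adj m n (A : 'M[H]_(m, n)) :
  cof (adjq A *m A) n *m (adjq A *m A) = (qreal (pdet (adjq A *m A) setT))%:M.
Proof.
apply/esym/eqP; rewrite -subr_eq0 -dsum_full -cofS ?adjq_gram //.
by rewrite cof_oversize.
Qed.

Lemma pdet_neq0_indep m n (A : 'M[H]_(m, n)) :
  pdet (adjq A *m A) setT != 0 -> col_indep A.
Proof.
move=> d0 v Av; apply: (qscale_inj d0); rewrite -mul_qscalar_mx -gram_adj -!mulmxA Av.
by rewrite !mulmx0 scaler0.
Qed.

(** For the largest [k] with [d_k] nonzero, [F T_{k+1} = 0]; injectivity of [F] gives [T_{k+1} = 0],
    so [T_k / d_k] inverts [F]. That [k] is [n] is not yet known. *)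
Lemma col_indep_solve m n (A : 'M[H]_(m, n)) (e : 'cV[H]_n) :
  col_indep A -> exists w, adjq A *m A *m w = e.
Proof.
move=> Ai; have Mi p (X : 'M[H]_(n, p)) : adjq A *m A *m X = 0 -> X = 0.
  move/adjq_mul_eq0 => AX; apply/matrixP => i j.
  have /colP/(_ i) : col j X = 0 by apply: Ai; rewrite colE mulmxA AX mul0mx.
  by rewrite !mxE.
pose P k := dsum (adjq A *m A) k != 0.
have exP : exists k, P k by exists 0%N; rewrite /P dsum0 oner_neq0.
have bP k : P k -> (k <= n)%N by rewrite leqNgt; apply: contra => /dsum_oversize->.
case: (ex_maxnP exP bP) => k dk kmax.
have d0 l : (k < l)%N -> dsum (adjq A *m A) l = 0.
  by move=> kl; apply/eqP; apply: contraTT kl => /kmax; rewrite -leqNgt.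
exists (qreal (dsum (adjq A *m A) k)^-1 *: (cof (adjq A *m A) k *m e)).
have := Mi _ _ (gram_cof_eq0 d0); rewrite cofS ?adjq_gram // => /eqP.
rewrite subr_eq0 => /eqP e1.
by rewrite qscaleAr mulmxA cof_comm ?adjq_gram // -e1 mul_qscalar_mx qscaleK.
Qed.

(* Cramer: if [F w = e_i], then [det F * w_i] is the minor of [F] without the index [i],
   and [w_i] is real and nonnegative because it equals [w^* F w]. *)
Lemma pdet_gram_gt0 m n (A : 'M[H]_(m, n)) :
  col_indep A -> 0 < pdet (adjq A *m A) setT.
Proof.
elim: n A => [|n IH] A Ai.
  by rewrite (_ : setT = set0) ?pdet0 //; apply/setP => -[].
pose i : 'I_n.+1 := ord0; pose b := [set: 'I_n.+1] :\ i.
have [w Fw] := col_indep_solve (delta_mx i 0) Ai.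
set F := adjq A *m A in Fw *.
have b0 : 0 < pdet F b.
  have bn : #|b| = n by have := cardsD1 i setT; rewrite inE cardsT card_ord add1n => -[].
  (* The size of [b] equals [n] only propositionally, so the hypothesis is restated for such
     sizes. *)
  have {}IH p (B : 'M[H]_(m, p)) : p = n -> col_indep B -> 0 < pdet (adjq B *m B) setT.
    by move=> pn; move: B; rewrite pn; exact: IH.
  rewrite -pdet_psub psub_gram; apply: IH => //.
  by apply: col_indep_colsub => //; exact: enum_val_inj.
have wi : w i 0 = qreal (sqnorm (A *m w)).
  rewrite -[LHS]qconjK -[RHS]qconj_real -adjq_mulE; congr qconj.
  rewrite adjqM -mulmxA [adjq A *m _]mulmxA Fw mxE (bigD1 i) //= big1 => [|k ki].
    by rewrite !mxE !eqxx mulr1 addr0.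
  by rewrite [delta_mx _ _ _ _]mxE (negPf ki) mulr0.
have : qreal (pdet F setT * sqnorm (A *m w)) = qreal (pdet F b).
  rewrite rmorphM /= -wi.
  (* The matrix has size [n.+1], so this [cof] is the adjugate; its entry at [(i, i)] is the minor
     on [b]. *)
  have /colP/(_ i) : (qreal (pdet F setT))%:M *m w = cof F n.+1 *m delta_mx i 0.
    by rewrite -gram_adj -mulmxA Fw.
  rewrite mul_qscalar_mx mxE => ->; rewrite -colE !mxE.
  rewrite (big_pred1 setT) => [|c]; first by rewrite pcof_diag ?inE.
  rewrite /= eqEcard subsetT cardsT card_ord /= eqn_leq.
  have -> : (#|c| <= n.+1)%N by rewrite -[X in (_ <= X)%N]card_ord max_card.
  have [ic|ic] := boolP (i \in c); rewrite ?andbT // andbF; apply/esym/negbTE.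
  rewrite -ltnNge -[X in (_ < X)%N]card_ord -cardsT proper_card //.
  by rewrite properEneq subsetT andbT; apply: contraNneq ic => ->; rewrite inE.
move/qreal_inj => e; move: b0; rewrite -e.
move: (sqnorm_ge0 (A *m w)); rewrite le_eqVlt => /predU1P[<-|s0].
  by rewrite mulr0 ltxx.
by rewrite pmulr_lgt0.
Qed.

Lemma pdet_gram_ge0 m n (A : 'M[H]_(m, n)) : 0 <= pdet (adjq A *m A) setT.
Proof.
have [->//|/pdet_neq0_indep/pdet_gram_gt0/ltW//] := eqVneq (pdet (adjq A *m A) setT) 0.
Qed.

(** Principal minors of [A^* A] are Gram determinants of sets of columns: nonnegative, positive on
    an independent set, and zero on more than [k] columns. *)
Lemma rank_dsum m n (A : 'M[H]_(m, n)) k : is_rankq A k ->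
  0 < dsum (adjq A *m A) k /\ forall l, (k < l)%N -> dsum (adjq A *m A) l = 0.
Proof.
move=> [[f [fi Ai]] kmax]; split; last first.
  move=> l kl; apply: big1 => b /eqP bl; apply/eqP.
  rewrite -pdet_psub psub_gram; apply: contraLR kl => /pdet_neq0_indep/kmax le.
  by rewrite -leqNgt -bl le //; exact: enum_val_inj.
pose b := f @: setT; have bk : #|b| = k by rewrite card_imset ?cardsT ?card_ord.
rewrite /dsum (bigD1 b) ?bk //=; apply: ltr_wpDr.
  by apply: sumr_ge0 => c _; rewrite -pdet_psub psub_gram pdet_gram_ge0.
rewrite -pdet_psub psub_gram; apply: pdet_gram_gt0.
(* The enumeration of [b] may list the columns in another order than [f]; [g] relates the two. *)
have gP (x : 'I_#|b|) : exists y, f y == enum_val x.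
  by have /imsetP[y _ ->] := enum_valP x; exists y.
pose g x := xchoose (gP x); have fg x : f (g x) = enum_val x by exact/eqP/(xchooseP (gP x)).
have gi : injective g by move=> x y /(congr1 f); rewrite !fg; exact: enum_val_inj.
have -> : colsub (fun x : 'I_#|b| => enum_val x) A = colsub g (colsub f A).
  by apply/matrixP => x y; rewrite !mxE fg.
exact: col_indep_colsub.
Qed.

End Positivity.

(** * Determinantal forms of the Moore-Penrose inverse *)

Section MoorePenrose.
Variable R : realType.
Local Notation H := (quat R).

Lemma is_MP_uniq m n (A : 'M[H]_(m, n)) X Y : is_MP A X -> is_MP A Y -> X = Y.
Proof.
move=> [AXA XAX AXh XAh] [AYA YAY AYh YAh].
have AXY : A *m X = A *m Y.
  by rewrite -AXh -[in LHS]AYA -mulmxA adjqM AXh AYh mulmxA AXA.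
have XYA : X *m A = Y *m A.
  rewrite -XAh -[in LHS]AYA -[A *m Y *m A]mulmxA [X *m _]mulmxA adjqM XAh YAh.
  by rewrite -mulmxA [A *m (X *m A)]mulmxA AXA.
by rewrite -XAX XYA -mulmxA AXY mulmxA YAY.
Qed.

Lemma is_MP_adjq m n (A : 'M[H]_(m, n)) X : is_MP A X -> is_MP (adjq A) (adjq X).
Proof.
move=> [AXA XAX AXh XAh]; split; rewrite -!adjqM.
- by rewrite mulmxA AXA.
- by rewrite mulmxA XAX.
- by rewrite !XAh.
- by rewrite !AXh.
Qed.

(** Any solution makes the [epsilon] choice a solution too, and uniqueness identifies them. *)
Lemma pinvq_eq m n (A : 'M[H]_(m, n)) X : is_MP A X -> pinvq A = X.
Proof.
move=> AX; apply: (is_MP_uniq _ AX); apply: epsilon_spec; by exists X.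
Qed.

Lemma pinvq_left m n (A : 'M[H]_(m, n)) k : is_rankq A k ->
  pinvq A = qreal (dsum (adjq A *m A) k)^-1 *: (cof (adjq A *m A) k *m adjq A).
Proof. by case/rank_dsum => d0 dl; apply: pinvq_eq; apply: mpinvP => //; rewrite gt_eqF. Qed.

(** The left form for [A^*], conjugate transposed; [dsum_gramC] transfers the rank information. *)
Lemma pinvq_right m n (A : 'M[H]_(m, n)) k : is_rankq A k ->
  pinvq A = qreal (dsum (A *m adjq A) k)^-1 *: (adjq A *m cof (A *m adjq A) k).
Proof.
case/rank_dsum => d0 dl; apply: pinvq_eq.
have dA : dsum (A *m adjq A) k != 0 by rewrite -dsum_gramC gt_eqF.
have dl' l : (k < l)%N -> dsum (A *m adjq A) l = 0 by move=> kl; rewrite -dsum_gramC dl.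
have := @mpinvP _ _ _ (adjq A) k; rewrite /mpinv adjqK => /(_ dl' dA)/is_MP_adjq.
by rewrite adjqK adjq_scale adjqM adjq_cof ?adjq_cogram.
Qed.

End MoorePenrose.

Lemma mulmx_qscale (R : realType) m n p q a b (X : 'M[quat R]_(m, n)) (C : 'M_(n, p))
    (Y : 'M_(p, q)) :
  (qreal a *: X) *m C *m (qreal b *: Y) = qreal (a * b) *: (X *m C *m Y).
Proof. by rewrite qscaleAr -!scalemxAl scalerA -rmorphM mulrC. Qed.

(** * Determinantal sums as matrix entries *)

Section CramerEntries.
Variables (R : realType) (n p : nat) (F : 'M[quat R]_n) (G : 'M[quat R]_p).
Hypotheses (Fh : adjq F = F) (Gh : adjq G = G).

Lemma cdsum_col k i q (X : 'M[quat R]_(n, q)) t :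
  cdsum F k i (col t X) = (cof F k *m X) i t.
Proof. by rewrite cdsumE // colE mulmxA -colE mxE. Qed.

Lemma rdsum_row k j q (X : 'M[quat R]_(q, p)) f :
  rdsum G k j (row f X) = (X *m cof G k) f j.
Proof. by rewrite rdsumE // -row_mul mxE. Qed.

(** Row sums first or column sums first, the value is an entry of the same triple product, whence
    the paired expressions of the theorem. *)
Lemma cdsum_rdsum k l i j (X : 'M[quat R]_(n, p)) :
  cdsum F k i (\col_h rdsum G l j (row h X)) = (cof F k *m X *m cof G l) i j.
Proof.
rewrite -mulmxA -cdsum_col; congr cdsum; apply/colP => h.
by rewrite mxE rdsum_row [RHS]mxE.
Qed.

Lemma rdsum_cdsum_col k l i j (X : 'M[quat R]_(n, p)) :
  rdsum G l j (\row_h cdsum F k i (col h X)) = (cof F k *m X *m cof G l) i j.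
Proof.
rewrite -rdsum_row; congr rdsum; apply/rowP => h.
by rewrite mxE cdsum_col [RHS]mxE.
Qed.

End CramerEntries.

Theorem theorem3p3 (R : realType) (m n r s p q : nat)
  (r1 r2 r3 r4 r5 r6 r7 : nat)
  (A1 : 'M[quat R]_(m, n)) (B1 : 'M[quat R]_(r, s))
  (A2 : 'M[quat R]_(m, p)) (B2 : 'M[quat R]_(q, s)) (C : 'M[quat R]_(m, s)) :
  let M := RA A1 *m A2 in
  let N := B2 *m LA B1 in
  let S := A2 *m LA M in
  is_rankq A1 r1 -> is_rankq B1 r2 -> is_rankq A2 r3 -> is_rankq B2 r4 ->
  is_rankq M r5 -> is_rankq N r6 -> is_rankq S r7 ->
  let X1 := pinvq A1 *m C *m pinvq B1
            - pinvq A1 *m A2 *m pinvq M *m C *m pinvq B1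
            - pinvq A1 *m S *m pinvq A2 *m C *m pinvq N *m B2 *m pinvq B1 in
  let X2 := pinvq M *m C *m pinvq B2 + PA S *m pinvq A2 *m C *m pinvq N in
  (* auxiliary matrices *)
  let C1 := adjq A1 *m C *m adjq B1 in
  let A2t := adjq A1 *m A2 in
  let C2 := adjq M *m C *m adjq B1 in
  let St := adjq A1 *m S in
  let B2t := B2 *m adjq B1 in
  let C3 := adjq A2 *m C *m adjq N in
  let C4 := adjq M *m C *m adjq B2 in
  let SS := adjq S *m S in
  (* Hermitian matrices *)
  let HA1 := adjq A1 *m A1 in
  let HB1 := B1 *m adjq B1 in
  let HM := adjq M *m M in
  let HA2 := adjq A2 *m A2 in
  let HN := N *m adjq N in
  let HB2 := B2 *m adjq B2 in
  let HS := adjq S *m S in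
  (* sums of principal minors *)
  let dA1 := minsum HA1 r1 in
  let dB1 := minsum HB1 r2 in
  let dA2 := minsum HA2 r3 in
  let dB2 := minsum HB2 r4 in
  let dM := minsum HM r5 in
  let dN := minsum HN r6 in
  let dS := minsum HS r7 in
  (* (1) *)
  let dB1c (j : 'I_r) : 'cV_n := \col_k rdsum HB1 r2 j (row k C1) in
  let dA1r (i : 'I_n) : 'rV_r := \row_l cdsum HA1 r1 i (col l C1) in
  let x11 i j := cdsum HA1 r1 i (dB1c j) * qinv (dA1 * dB1) in
  let x11' i j := rdsum HB1 r2 j (dA1r i) * qinv (dA1 * dB1) in
  (* (2) *)
  let psiB1 (j : 'I_r) : 'cV_p := \col_k rdsum HB1 r2 j (row k C2) in
  let psiM (t : 'I_p) : 'rV_r := \row_l cdsum HM r5 t (col l C2) in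
  let phi t j := cdsum HM r5 t (psiB1 j) in
  let phi' t j := rdsum HB1 r2 j (psiM t) in
  let x12 i j := (\sum_(t < p) cdsum HA1 r1 i (col t A2t) * phi t j)
                 * qinv (dA1 * dM * dB1) in
  (* (3) *)
  let zetaN (f : 'I_q) : 'cV_p := \col_k rdsum HN r6 f (row k C3) in
  let zetaA2 (t : 'I_p) : 'rV_q := \row_l cdsum HA2 r3 t (col l C3) in
  let eta t f := cdsum HA2 r3 t (zetaN f) in
  let eta' t f := rdsum HN r6 f (zetaA2 t) in
  let x13 i j := (\sum_(t < p) \sum_(f < q)
                    cdsum HA1 r1 i (col t St) * eta t f
                    * rdsum HB1 r2 j (row f B2t))
                 * qinv (dA1 * dA2 * dN * dB1) in
  (* (4) *)
  let dB2c (f : 'I_q) : 'cV_p := \col_k rdsum HB2 r4 f (row k C4) in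
  let dMr (g : 'I_p) : 'rV_q := \row_l cdsum HM r5 g (col l C4) in
  let x21 g f := cdsum HM r5 g (dB2c f) * qinv (dM * dB2) in
  let x21' g f := rdsum HB2 r4 f (dMr g) * qinv (dM * dB2) in
  (* (5) *)
  let x22 g f := (\sum_(t < p) cdsum HS r7 g (col t SS) * eta t f)
                 * qinv (dS * dA2 * dN) in
  (forall (i : 'I_n) (j : 'I_r), X1 i j = x11 i j - x12 i j - x13 i j) /\
  (forall (g : 'I_p) (f : 'I_q), X2 g f = x21 g f + x22 g f) /\
  (forall (i : 'I_n) (j : 'I_r), x11 i j = x11' i j) /\
  (forall (t : 'I_p) (j : 'I_r), phi t j = phi' t j) /\
  (forall (t : 'I_p) (f : 'I_q), eta t f = eta' t f) /\
  (forall (g : 'I_p) (f : 'I_q), x21 g f = x21' g f).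
Proof.
move=> M N S; clearbody S N; clearbody M => hA1 hB1 hA2 hB2 hM hN hS X1 X2 C1 A2t C2 St B2t C3 C4 SS.
move=> HA1 HB1 HM HA2 HN HB2 HS dA1 dB1 dA2 dB2 dM dN dS.
move=> dB1c dA1r x11 x11' psiB1 psiM phi phi' x12 zetaN zetaA2 eta eta' x13.
move=> dB2c dMr x21 x21' x22.
have etaE t f : eta t f = (cof HA2 r3 *m C3 *m cof HN r6) t f.
  by apply: cdsum_rdsum; [exact: adjq_gram|exact: adjq_cogram].
have phiE t j : phi t j = (cof HM r5 *m C2 *m cof HB1 r2) t j.
  by apply: cdsum_rdsum; [exact: adjq_gram|exact: adjq_cogram].
(* The denominators are real, so their inverses are real and central. *)
have q2 a b : qinv (qreal a * qreal b) = qreal (a * b)^-1 :> quat R.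
  by rewrite -rmorphM qinv_real.
have q3 a b c : qinv (qreal a * qreal b * qreal c) = qreal (a * b * c)^-1 :> quat R.
  by rewrite -rmorphM q2.
have q4 a b c e : qinv (qreal a * qreal b * qreal c * qreal e) =
    qreal (a * b * c * e)^-1 :> quat R by rewrite -rmorphM q3.
have dE a b (A : 'M[quat R]_(a, b)) k :
    minsum (adjq A *m A) k = qreal (dsum (adjq A *m A) k).
  by apply: minsumE; exact: adjq_gram.
have dE' a b (A : 'M[quat R]_(a, b)) k :
    minsum (A *m adjq A) k = qreal (dsum (A *m adjq A) k).
  by apply: minsumE; exact: adjq_cogram.
split; [|split; [|split; [|split; [|split]]]].
- move=> i j; pose Y11 := cof HA1 r1 *m C1 *m cof HB1 r2.
  pose Y12 := cof HA1 r1 *m A2t *m (cof HM r5 *m C2 *m cof HB1 r2).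
  pose Y13 := cof HA1 r1 *m St *m (cof HA2 r3 *m C3 *m cof HN r6) *m (B2t *m cof HB1 r2).
  have e11 : x11 i j = qreal (dsum HA1 r1 * dsum HB1 r2)^-1 * Y11 i j.
    rewrite [RHS]qreal_comm; congr (_ * _); last by rewrite /dA1 /dB1 dE dE'; exact: q2.
    by apply: cdsum_rdsum; [exact: adjq_gram|exact: adjq_cogram].
  have e12 : x12 i j = qreal (dsum HA1 r1 * dsum HM r5 * dsum HB1 r2)^-1 * Y12 i j.
    rewrite [RHS]qreal_comm; congr (_ * _); last by rewrite /dA1 /dM /dB1 2!dE dE'; exact: q3.
    rewrite [RHS]mxE; apply: eq_bigr => t _.
    by rewrite phiE cdsum_col //; exact: adjq_gram.
  have e13 : x13 i j =
      qreal (dsum HA1 r1 * dsum HA2 r3 * dsum HN r6 * dsum HB1 r2)^-1 * Y13 i j.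
    rewrite [RHS]qreal_comm; congr (_ * _); last first.
      by rewrite /dA1 /dA2 /dN /dB1 2!dE 2!dE'; exact: q4.
    (* The way [Y13] is associated makes [f] the outer summation index. *)
    rewrite [RHS]mxE exchange_big; apply: eq_bigr => f _.
    rewrite [X in X * _]mxE mulr_suml; apply: eq_bigr => t _.
    by rewrite etaE rdsum_row ?cdsum_col //; [exact: adjq_gram|exact: adjq_cogram].
  have X1E : X1 = qreal (dsum HA1 r1 * dsum HB1 r2)^-1 *: Y11
      - qreal (dsum HA1 r1 * dsum HM r5 * dsum HB1 r2)^-1 *: Y12
      - qreal (dsum HA1 r1 * dsum HA2 r3 * dsum HN r6 * dsum HB1 r2)^-1 *: Y13.
    (* Inverses giving column determinants are expanded through [A^* A], those giving row
       determinants through [B B^*]. *)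
    rewrite /X1 (pinvq_left hA1) (pinvq_right hB1) (pinvq_left hM) (pinvq_left hA2).
    rewrite (pinvq_right hN) !mulmx_qscale -!invfM.
    rewrite /Y11 /Y12 /Y13 /C1 /C2 /C3 /A2t /St /B2t /HA1 /HM /HB1 /HA2 /HN.
    move: (adjq A1) (adjq B1) (adjq M) (adjq A2) (adjq N) => A1' B1' M' A2' N'.
    by rewrite !mulmxA.
  by rewrite X1E e11 e12 e13; move: Y11 Y12 Y13 {e11 e12 e13 X1E} => Y11 Y12 Y13; rewrite !mxE.
- move=> g f; pose Y21 := cof HM r5 *m C4 *m cof HB2 r4.
  pose Y22 := cof HS r7 *m SS *m (cof HA2 r3 *m C3 *m cof HN r6).
  have e21 : x21 g f = qreal (dsum HM r5 * dsum HB2 r4)^-1 * Y21 g f.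
    rewrite [RHS]qreal_comm; congr (_ * _); last by rewrite /dM /dB2 dE dE'; exact: q2.
    by apply: cdsum_rdsum; [exact: adjq_gram|exact: adjq_cogram].
  have e22 : x22 g f = qreal (dsum HS r7 * dsum HA2 r3 * dsum HN r6)^-1 * Y22 g f.
    rewrite [RHS]qreal_comm; congr (_ * _); last by rewrite /dS /dA2 /dN 2!dE dE'; exact: q3.
    rewrite [RHS]mxE; apply: eq_bigr => t _.
    by rewrite etaE cdsum_col //; exact: adjq_gram.
  have X2E : X2 = qreal (dsum HM r5 * dsum HB2 r4)^-1 *: Y21
      + qreal (dsum HS r7 * dsum HA2 r3 * dsum HN r6)^-1 *: Y22.
    (* The left form turns the projector [PA S] into a multiple of [cof HS r7 *m SS], the source of
       the columns of [S^* S]. *)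
    rewrite /X2 /PA (pinvq_left hS) (pinvq_right hB2) (pinvq_left hM) (pinvq_left hA2).
    rewrite (pinvq_right hN) !mulmx_qscale -!invfM.
    rewrite /Y21 /Y22 /SS /C4 /C3 /HM /HB2 /HS /HA2 /HN.
    move: (adjq M) (adjq B2) (adjq S) (adjq A2) (adjq N) => M' B2' S' A2' N'.
    by rewrite !mulmxA.
  by rewrite X2E e21 e22; move: Y21 Y22 {e21 e22 X2E} => Y21 Y22; rewrite !mxE.
- move=> i j; congr (_ * _); rewrite cdsum_rdsum ?rdsum_cdsum_col //;
    by [exact: adjq_gram|exact: adjq_cogram].
- move=> t j; rewrite phiE; apply/esym/rdsum_cdsum_col;
    by [exact: adjq_gram|exact: adjq_cogram].
- move=> t f; rewrite etaE; apply/esym/rdsum_cdsum_col;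
    by [exact: adjq_gram|exact: adjq_cogram].
- move=> g f; congr (_ * _); rewrite cdsum_rdsum ?rdsum_cdsum_col //;
    by [exact: adjq_gram|exact: adjq_cogram].
Qed.
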